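(* (One-dimensional distance of a resolvent to the span of finitely many others.) Let $0<c_0<c_1$ be constants and $\Sigma^0=\{\sigma\in L^\infty(0,1):\ c_0\le\sigma\le c_1\text{ a.e. in }(0,1)\}$. Let $N\ge2$, let $\tau,\sigma_1,\dots,\sigma_N\in\Sigma^0$, and write $R_i=R_{\sigma_i}$ for $1\le i\le N$. Then for all real $a_1,\dots,a_N$, $$\left\|R_\tau-\sum_{i=1}^Na_iR_i\right\|_*=\left\|\sum_{i=1}^N\frac{a_i}{\sigma_i}-\frac1\tau\right\|_{L^\infty(0,1)},$$ and consequently $$\mathrm{dist}_*\big(R_\tau,\mathrm{span}[R_i,\ 1\le i\le N]\big)=\mathrm{dist}_{L^\infty(0,1)}\left(\frac1\tau,\mathrm{span}\left[\frac1{\sigma_i},\ 1\le i\le N\right]\right),$$ where $\mathrm{dist}_*$ is the distance induced by the norm $\|\cdot\|_*$.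
   Context: Let $H=\{u\in H^1(0,1):u(1)=0\}$ with norm $\|u_x\|_{L^2(0,1)}$, and $H'$ its dual. For $\sigma\in\Sigma^0$ and $f\in H'$, $R_\sigma f=u_\sigma\in H$ is the unique solution of $\int_0^1\sigma u_xv_x\,dx=\langle f,v\rangle$ for all $v\in H$, i.e. the variational solution of $-(\sigma u_x)_x=f$ in $(0,1)$, $u_x(0)=0$, $u(1)=0$. For $f\in L^2(0,1)$ one has $(R_\sigma f)_x(x)=-\frac1{\sigma(x)}\int_0^xf(t)\,dt$ a.e. in $(0,1)$. $W^{-1,1}(0,1)$ is the closure (completion) of $C_0^\infty(0,1)$ for the norm $\|f\|_{W^{-1,1}(0,1)}=\left\|\int_0^xf(t)\,dt\right\|_{L^1(0,1)}$. For $m\in L^\infty(0,1)$, $T_m:W^{-1,1}(0,1)\to L^1(0,1)$ is the bounded linear operator given by $T_mf(x)=m(x)\int_0^xf(t)\,dt$ (extended by continuity from $C_0^\infty(0,1)$), and $\|\cdot\|_{-1,1}$ is the operator norm in $\mathscr{B}(W^{-1,1}(0,1),L^1(0,1))$. The norm $\|\cdot\|_*$ is defined by $\|R_\sigma\|_*=\|T_{1/\sigma}\|_{-1,1}$ and, on linear combinations of resolvents, as the $\mathscr{B}(W^{-1,1}(0,1),L^1(0,1))$ norm of the corresponding operator $f\mapsto(\sum_jb_jR_{\rho_j}f)_x$, i.e. $\|\sum_jb_jR_{\rho_j}\|_*=\|\sum_jb_jT_{1/\rho_j}\|_{-1,1}$ for real $b_j$ and $\rho_j\in\Sigma^0$.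 *)

(* Defs.v *)
From HB Require Import structures.
From mathcomp Require Import all_boot all_order all_algebra.
From mathcomp Require Import all_classical all_reals all_analysis measurable_realfun.
Import Order.TTheory GRing.Theory Num.Theory.
Import numFieldNormedType.Exports.

Set Implicit Arguments.
Unset Strict Implicit.
Unset Printing Implicit Defensive.

Local Open Scope classical_set_scope.
Local Open Scope ring_scope.

(* Functions on (0,1) are represented by functions on R, integrated against    *)
(* Lebesgue measure restricted to ]0, 1[; elements of Lebesgue spaces are      *)
(* represented by functions rather than by classes for equality almost         *)
(* everywhere. Except for Hnorm, norms and distances are extended reals, so    *)
(* that an infimum over the empty set or an unbounded supremum is +oo.         *)

Section unit_interval.
Context {R : realType}.

Let meas01 : measurable (`]0, 1[%classic : set (measurableTypeR R)).
Proof. exact: measurable_itv. Qed.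

Definition leb01 : {measure set (measurableTypeR R) -> \bar R} :=
  mrestr (@lebesgue_measure R) meas01.

Definition L1fun := LfunType leb01 (lexx 1%E).
Definition L2fun := LfunType leb01 (lee1n 2 : (1 <= 2%:E)%E).

Definition L1norm (f : R -> R) : \bar R := ('N[leb01]_1%:E [EFin \o f])%E.
Definition L2norm (f : R -> R) : \bar R := ('N[leb01]_2%:E [EFin \o f])%E.
Definition Linfnorm (f : R -> R) : \bar R := ('N[leb01]_+oo [EFin \o f])%E.

End unit_interval.

Section sobolev.
Context {R : realType}.
Implicit Types (phi u : R -> R).

Definition C0inf : set (R -> R) := [set phi |
  (forall n x, derivable (derive1n n phi) x 1) /\
  exists a b : R, [/\ 0 < a, b < 1 & forall x, x \notin `[a, b] -> phi x = 0]].

Definition weak_derivative u (g : L2fun (R := R)) :=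
  forall phi, C0inf phi ->
    \int[leb01]_x (u x * derive1 phi x) = - \int[leb01]_x (g x * phi x).

Definition H1 : set (R -> R) := [set u |
  u \in Lfun leb01 2%:E /\ exists g, weak_derivative u g].

(* An element of H is its continuous representative on [0, 1] (so that the     *)
(* condition u(1) = 0 makes sense), extended by zero to R so that equality in  *)
(* H is equality of functions.                                                 *)
Definition inH : {pred R -> R} := [pred u | `[< [/\ H1 u,
  {within `[0, 1], continuous u}, u 1 = 0 &
  forall x, x \notin `[0, 1] -> u x = 0] >]].

Lemma C0inf_continuous n phi : C0inf phi -> continuous (derive1n n phi).
Proof.
move=> [dphi _] x; apply: differentiable_continuous.
by apply/derivable1_diffP; exact: dphi.
Qed.

Lemma continuous_Lfun2 phi : continuous phi -> phi \in Lfun (@leb01 R) 2%:E.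
Proof.
move=> cphi.
have mphi : measurable_fun [set: measurableTypeR R] phi.
  exact: continuous_measurable_fun.
rewrite inE; apply/andP; split; first by rewrite inE.
rewrite inE/= /finite_norm unlock poweR_lty//.
have /compact_bounded[M [_ /(_ (M + 1)) Mphi]] : compact (phi @` `[0, 1]).
  apply: continuous_compact; last exact: segment_compact.
  by apply: continuous_subspaceT => x; exact: cphi.
have {}Mphi x : x \in `[0, 1] -> `|phi x| <= `|M + 1|.
  move=> x01; rewrite (le_trans _ (ler_norm _))//; apply: Mphi; last by exists x.
  by rewrite ltrDl.
have fin01 : (leb01 [set: measurableTypeR R] < +oo)%E.
  by rewrite /leb01/= /mrestr setTI lebesgue_measure_itv/= lte_fin ltr01 ltry.
have : (\int[leb01]_x cst (`|M + 1| `^ 2)%:E x < +oo)%E.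
  rewrite integral_cst//= lte_mul_pinfty// ?lee_fin ?powR_ge0//.
apply: le_lt_trans; apply: ae_ge0_le_integral => //=.
- apply/measurable_EFinP; apply: (measurableT_comp (measurable_powR _)) => //.
  exact: measurableT_comp.
- exists (~` (`[0, 1]%classic : set (measurableTypeR R))); split => //.
  + by apply: measurableC; exact: measurable_itv.
  + rewrite /leb01/= /mrestr.
    rewrite [X in lebesgue_measure X](_ : _ = set0) ?measure0//.
    apply/seteqP; split => // x/= []; rewrite !in_itv/= => x01 /andP[/ltW x0 /ltW x1].
    by apply: x01; rewrite x0 x1.
  + move=> x /= h x01; apply: h => _.
    by rewrite lee_fin ge0_ler_powR// ?nnegrE//; exact: Mphi.
Qed.

Lemma C0inf_Lfun2 n phi : C0inf phi -> derive1n n phi \in Lfun (@leb01 R) 2%:E.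
Proof. by move=> /C0inf_continuous => /(_ n); exact: continuous_Lfun2. Qed.

Lemma inH_submod_closed : submod_closed inH.
Proof.
split.
  apply/asboolP; split => //; last exact: cst_continuous.
  split; first by have [] := Lfun_submod_closed (@leb01 R) (lee1n 2).
  exists 0 => phi phiC; under eq_Rintegral do rewrite mul0r.
  under [in RHS]eq_Rintegral do rewrite mul0r.
  by rewrite /Rintegral integral0 oppr0.
move=> a u v /asboolP[[Lu [g ug]] cu u1 u0] /asboolP[[Lv [h vh]] cv v1 v0].
apply/asboolP; split.
- split; first by have [_] := Lfun_submod_closed (@leb01 R) (lee1n 2); apply.
  exists (a *: g + h) => phi phiC.
  have L0 := C0inf_Lfun2 0 phiC; have L1 := C0inf_Lfun2 1 phiC.
  have I (f k : R -> R) : f \in Lfun (@leb01 R) 2%:E ->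
      k \in Lfun (@leb01 R) 2%:E ->
      (@leb01 R).-integrable setT (EFin \o (f \* k)).
    by move=> Lf Lk; apply/Lfun1_integrable; exact: Lfun2_mul_Lfun1.
  have lin (f k m : R -> R) : f \in Lfun (@leb01 R) 2%:E ->
      k \in Lfun (@leb01 R) 2%:E -> m \in Lfun (@leb01 R) 2%:E ->
      \int[leb01]_x ((a *: f + k) x * m x) =
      a * \int[leb01]_x (f x * m x) + \int[leb01]_x (k x * m x).
    move=> Lf Lk Lm; have If := I _ _ Lf Lm; have Ik := I _ _ Lk Lm.
    rewrite -RintegralZl// -RintegralD//; last first.
      by have := integrableZl measurableT a If.
    by apply: eq_Rintegral => x _; rewrite /GRing.scale/= mulrDl mulrA.
  rewrite (lin _ _ _ Lu Lv L1) (lin _ _ _ (LfunP g) (LfunP h) L0).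
  by rewrite ug// vh// opprD mulrN.
- move=> x; apply: cvgD; last exact: cv.
  by apply: cvgZr; exact: cu.
- have -> : (a *: (u : R -> R) + v) 1 = a * u 1 + v 1 by [].
  by rewrite u1 v1 mulr0 addr0.
- move=> x x01; have -> : (a *: (u : R -> R) + v) x = a * u x + v x by [].
  by rewrite u0// v0// mulr0 addr0.
Qed.

HB.instance Definition _ :=
  GRing.isSubmodClosed.Build R (R -> R) inH inH_submod_closed.

End sobolev.

Record H (R : realType) := MkH { H_fun :> R -> R; _ : H_fun \in inH }.

HB.instance Definition _ (R : realType) := [isSub for @H_fun R].
HB.instance Definition _ (R : realType) := [Choice of H R by <:].
HB.instance Definition _ (R : realType) := [SubChoice_isSubLmodule of H R by <:].

Section resolvent.
Context {R : realType}.

(* u_x, defined up to almost everywhere equality *)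
Definition dx (u : H R) : L2fun (R := R) := xget 0 [set g | weak_derivative u g].

Definition Hnorm (u : H R) : R := fine (L2norm (dx u)).

Record Hdual := MkHdual {
  Hdual_form :> {scalar H R};
  Hdual_bounded : exists C : R, forall v, `|Hdual_form v| <= C * Hnorm v }.

HB.instance Definition _ := gen_eqMixin Hdual.
HB.instance Definition _ := gen_choiceMixin Hdual.

Fact Hdual0_subproof : exists C : R, forall v,
  `|(GRing.null_fun _ : {scalar H R}) v| <= C * Hnorm v.
Proof. by exists 0 => v; rewrite normr0 mul0r. Qed.
Definition Hdual0 : Hdual := MkHdual Hdual0_subproof.

(* The unique solution when c0 <= sigma <= c1 almost everywhere, 0 < c0. *)
Definition resolvent (sigma : R -> R) (F : Hdual) : H R :=
  xget 0 [set u | forall v : H R,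
    \int[leb01]_x (sigma x * dx u x * dx v x) = F v].

(* A function f in L^2 (in particular a test function) as an element of H';   *)
(* the functional below is bounded by the Poincare inequality, so the default  *)
(* Hdual0 plays no role.                                                       *)
Definition in_dual (f : R -> R) : Hdual :=
  xget Hdual0 [set F | forall v : H R, F v = \int[leb01]_x (f x * v x)].

End resolvent.
Arguments Hdual : clear implicits.

Section negative_sobolev.
Context {R : realType}.

Definition primitive (f : R -> R) (x : R) : R :=
  \int[lebesgue_measure]_(t in `[0, x]) f t.

Definition Wm11norm (f : R -> R) : \bar R := L1norm (primitive f).

(* W^{-1,1}(0,1), the completion of C_0^infty for Wm11norm, as the type of     *)
(* Cauchy sequences of test functions. Sequences whose difference tends to     *)
(* zero are not identified; neither the norm nor the operators below           *)
(* distinguish them.                                                           *)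
Record Wm11 := MkWm11 {
  Wm11_seq :> nat -> R -> R;
  Wm11_test : forall n, C0inf (Wm11_seq n);
  Wm11_cauchy : forall e : R, 0 < e -> exists N, forall m n,
    (N <= m)%N -> (N <= n)%N -> (Wm11norm (Wm11_seq m - Wm11_seq n)%R < e%:E)%E }.

Definition completed_norm (w : Wm11) : \bar R :=
  limn (fun n => Wm11norm (w n)).

(* Extension by continuity to W^{-1,1} of an operator L : C_0^infty -> L^1     *)
(* (linear and bounded for the norm Wm11norm).                                 *)
Definition extension (L : (R -> R) -> R -> R) (w : Wm11) : L1fun (R := R) :=
  xget 0 [set g : L1fun |
    (fun n => L1norm (L (w n) - (g : R -> R))%R) @ \oo --> 0%E].

(* Norm in B(W^{-1,1}, L^1) of the extension of L. *)
Definition norm_m11 (L : (R -> R) -> R -> R) : \bar R :=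
  ereal_sup [set L1norm (extension L w) | w in [set w | (completed_norm w <= 1)%E]].

(* For A = \sum_j b_j R_(rho_j), the operator f |-> (A f)_x is minus the        *)
(* multiplication operator f |-> \sum_j (b_j / rho_j) \int_0^x f on C_0^infty.  *)
Definition star_norm (A : Hdual R -> H R) : \bar R :=
  norm_m11 (fun f => dx (A (in_dual f))).

End negative_sobolev.

Definition Sigma0 (R : realType) (c0 c1 : R) : set (R -> R) := [set sigma |
  sigma \in Lfun leb01 +oo%E /\
  {ae (@leb01 R), forall x, c0 <= sigma x <= c1}].

Definition span_of (R : realType) (V : lmodType R) (N : nat) (v : 'I_N -> V)
  : set V := [set \sum_(i < N) a i *: v i | a in [set: 'I_N -> R]].

Definition dist_to (R : realType) (V : zmodType) (nm : V -> \bar R)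
  (x : V) (S : set V) : \bar R := ereal_inf [set nm (x - y) | y in S].

(* Main.v *)
Require Import Defs.
From HB Require Import structures.
From mathcomp Require Import all_boot all_order all_algebra.
From mathcomp Require Import all_classical all_reals all_analysis measurable_realfun.
From mathcomp Require Import ess_sup_inf ring.
Import Order.TTheory GRing.Theory Num.Theory.
Import numFieldNormedType.Exports.
Local Open Scope classical_set_scope.
Local Open Scope ring_scope.

(** For a test function [f] with primitive [F] vanishing at 0, the equation of a
    resolvent integrates once to [sigma u_x = - F].  Hence the operator attached
    to [R_tau - sum_i a_i R_i] sends [f] to [m F] with
    [m = sum_i a_i / sigma_i - 1 / tau], and since the norm of [f] in the
    negative space is the L^1 norm of [F], the star norm is the norm of
    multiplication by [m] among the available primitives.

    It is at most the essential supremum of [|m|].  It is not smaller because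
    every test function is the primitive of its own derivative, so that a bound
    [K] for the operator gives [int |m| phi <= K int phi] for all nonnegative
    test functions [phi]; test functions detect signs almost everywhere
    ([tested_ge0]), whence [|m| <= K] a.e.  This is [norm_m11_multiplication].
    The equality of the distances follows because the two infima run over the
    same coefficients [a].

    The formula for the resolvent ([dx_resolvent]) rests on three facts:
    - an element of H is almost everywhere the integral of its weak derivative
      starting from the point 1 ([H_antider]), which combines the lemma of
      du Bois-Reymond with the boundary condition; conversely every L^2 function
      is the weak derivative of such an integral ([antider_inH]);
    - exchanging integrals in that representation gives
      [int f v = - int v_x F] ([Rintegral_H]), which both shows that [f] is a
      bounded functional on H and rewrites the variational equation as
      [int (sigma u_x + F) v_x = 0];
    - the weak derivatives [v_x] include all test functions, so that
      [sigma u_x + F = 0] a.e.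

    Enough test functions come from the flat functions [x^-n exp (-1/x)], whose
    products give bumps; powers of a bump produce plateaus that increase to the
    indicator of an arbitrary interval ([plateau_cvg]).  Together with
    Lebesgue differentiation they give [tested_ge0]. *)

Set Implicit Arguments.
Unset Strict Implicit.
Unset Printing Implicit Defensive.

Local Notation mu := (@lebesgue_measure _).
Local Notation integrable01 f := ((@leb01 _).-integrable setT (EFin \o f)).
Local Notation measurableR f := (measurable_fun [set: measurableTypeR _] f).

(** * Test functions *)

Section test_functions.
Context {R : realType}.
Implicit Types (f g : R -> R) (a b x : R).

Definition smooth f := forall n x, derivable (derive1n n f) x 1.

(** Coinduction: a class of differentiable functions that is stable under
    differentiation consists of smooth functions.  Smoothness of a family is
    then proved by exhibiting one such class that contains it. *)
Lemma smooth_coind (S : set (R -> R)) :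
  (forall f, S f -> (forall x, derivable f x 1) /\ S (derive1 f)) ->
  forall f, S f -> smooth f.
Proof.
move=> HS f Sf n; suff : S (derive1n n f) by move=> /HS[].
by elim: n => [//|n IHn]; rewrite derive1nS; have [] := HS _ IHn.
Qed.

Lemma smooth_derive1 f : smooth f -> smooth (derive1 f).
Proof. by move=> sf n x; rewrite -derive1Sn; exact: sf. Qed.

Lemma smooth_antiderivative f g : (forall x, is_derive x 1 f (g x)) -> smooth g ->
  smooth f.
Proof.
move=> fg sg [|n] x; first by have [] := fg x.
rewrite derive1Sn (_ : derive1 f = g)//.
by apply/funext => y; rewrite derive1E; have [] := fg y.
Qed.

Lemma smooth_lin f g (c : R) : smooth f -> smooth g -> smooth (fun x => f x + c * g x).
Proof.
move=> sf sg.
pose S := [set h | exists u v : R -> R,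
  [/\ smooth u, smooth v & h = (fun x => u x + c * v x)]].
apply: (@smooth_coind S); last by exists f, g.
move=> _ [u [v [su sv ->]]].
have du x : is_derive x 1 u (derive1 u x).
  by rewrite derive1E; exact/derivableP/(su 0%N).
have dv x : is_derive x 1 v (derive1 v x).
  by rewrite derive1E; exact/derivableP/(sv 0%N).
have duv x : is_derive x 1 (fun x => u x + c * v x) (derive1 u x + c * derive1 v x).
  exact: (@is_deriveD _ _ _ u (c \*: v)).
split; first by move=> x; have [] := duv x.
exists (derive1 u), (derive1 v); split; [exact: smooth_derive1..|].
by apply/funext => x; rewrite derive1E; have [] := duv x.
Qed.

Lemma is_derive_near0 f x : (\forall y \near x, f y = 0) -> is_derive x 1 f 0.
Proof.
move=> f0; have d0 : is_derive x 1 (cst 0 : R -> R) 0 by exact: is_derive_cst.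
apply: near_eq_is_derive d0.
by apply: filterS f0 => y ->.
Qed.

(** The family of the [x^-n exp (-1/x)], extended by 0 to the left, is stable
    under differentiation up to linear combinations; it contains the classical
    smooth function [exp (-1/x)] that is flat at the origin. *)
Definition flat n x := if 0 < x then x^-1 ^+ n * expR (- x^-1) else 0.

Lemma flat_le0 n x : x <= 0 -> flat n x = 0.
Proof. by rewrite /flat ltNge => ->. Qed.

Lemma flat_ge0 n x : 0 <= flat n x.
Proof.
by rewrite /flat; case: ifP => // x0; rewrite mulr_ge0 ?expR_ge0// exprn_ge0// invr_ge0 ltW.
Qed.

(** With [y = 1/x] this says [y^(n+1) / (n+1)! <= exp y] for positive [x]. *)
Lemma flat_le n x : 0 <= x -> flat n x <= n.+1`!%:R * x.
Proof.
rewrite le_eqVlt => /predU1P[<-|x0]; first by rewrite flat_le0// mulr0.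
rewrite /flat x0 expRN -ler_pdivrMr// mulrAC -exprSr ler_pdivrMr ?expR_gt0//.
rewrite mulrC -ler_pdivrMr ?ltr0n ?fact_gt0//.
apply: le_trans (expR_ge1Dxn n _); last by rewrite invr_ge0 ltW.
by rewrite lerDr.
Qed.

Lemma flat_cvg0 n : flat n x @[x --> (0:R)] --> (0:R).
Proof.
apply/cvgr0Pnorm_lt => e e0.
have C0 : 0 < n.+1`!%:R :> R by rewrite ltr0n fact_gt0.
have h : \forall x \near nbhs (0 : R), x < e / n.+1`!%:R.
  by apply: lt_nbhsl; exact: divr_gt0.
apply: filterS h => x xe.
have [x0|x0] := leP 0 x; last by rewrite flat_le0 ?normr0// ltW.
rewrite ger0_norm ?flat_ge0//; apply: (le_lt_trans (flat_le n x0)).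
by rewrite mulrC -ltr_pdivlMr.
Qed.

(** The only delicate point is the origin, where the difference quotient of
    [flat n] is [flat n.+1], which tends to 0. *)
Lemma is_derive_flat n x :
  is_derive x 1 (flat n) (flat n.+2 x - n%:R * flat n.+1 x).
Proof.
have [x0|x0|->] := ltgtP x 0.
- rewrite !flat_le0 ?mulr0 ?subr0 ?(ltW x0)//.
  apply: is_derive_near0; near=> y; rewrite flat_le0// ltW//; near: y.
  exact: lt_nbhsl.
- have dV : is_derive x 1 (fun y : R => y^-1) (- x ^- 2).
    have d := @is_deriveV _ id x 1 1 (lt0r_neq0 x0) (is_derive_id _ _).
    by apply: (is_derive_eq d); rewrite /GRing.scale/= mulr1.
  have dN : is_derive x 1 (fun y : R => - y^-1) (x ^- 2).
    have d := @is_deriveN _ _ _ _ x 1 _ dV.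
    by apply: (is_derive_eq d); rewrite opprK.
  have dE := @is_derive1_comp _ expR _ x _ _ (is_derive_expR _) dN.
  have dX := @is_deriveX _ _ (fun y : R => y^-1) n x 1 _ dV.
  have dM := @is_deriveM _ _ _ _ _ _ _ _ dX dE.
  have E : \forall y \near x,
      ((fun z : R => z^-1) ^+ n * (expR \o (fun z : R => - z^-1))) y = flat n y.
    by near=> y; rewrite !fctE /flat ifT//=; near: y; exact: lt_nbhsr.
  apply: (is_derive_eq (near_eq_is_derive E dM)).
  rewrite /flat x0 /GRing.scale/= !fctE.
  rewrite -exprVn; case: n {dX dM E} => [|n] /=.
    by rewrite !mul0r !mulr0 mul1r addr0 subr0 mulrC.
  set y := x^-1; set E := expR _; rewrite !exprS; ring.
- rewrite !flat_le0 // mulr0 subr0; apply/is_derive1_caratheodory.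
  exists (flat n.+1); split; last by rewrite flat_le0.
    move=> z; rewrite (flat_le0 _ (lexx 0)) !subr0 /flat.
    case: ifP => z0; last by rewrite mul0r.
    by rewrite exprSr -!mulrA; congr (_ * _); rewrite mulrCA mulVf ?mulr1// gt_eqF.
  by rewrite /prop_for /continuous_at flat_le0//; exact: flat_cvg0.
Unshelve. all: by end_near. Qed.

(** The algebra generated by the flat functions based at the two endpoints; it
    is stable under differentiation, hence made of smooth functions. *)
Inductive bump_algebra a b : (R -> R) -> Prop :=
| bump_left n : bump_algebra a b (fun x => flat n (x - a))
| bump_right n : bump_algebra a b (fun x => flat n (b - x))
| bump_cst c : bump_algebra a b (fun=> c)
| bump_add f g : bump_algebra a b f -> bump_algebra a b g ->
    bump_algebra a b (fun x => f x + g x)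
| bump_mul f g : bump_algebra a b f -> bump_algebra a b g ->
    bump_algebra a b (fun x => f x * g x).

Lemma bump_algebraZ a b c f :
  bump_algebra a b f -> bump_algebra a b (fun x => c * f x).
Proof. by move=> fab; apply: bump_mul => //; exact: bump_cst. Qed.

Lemma bump_algebra_smooth a b f : bump_algebra a b f -> smooth f.
Proof.
apply: (@smooth_coind [set h | bump_algebra a b h]) => {}f /= fab.
suff [g gab fg] : exists2 g, bump_algebra a b g & forall x, is_derive x 1 f (g x).
  split; first by move=> x; have [] := fg x.
  rewrite (_ : derive1 f = g)//.
  by apply/funext => x; rewrite derive1E; have [] := fg x.
elim: fab => {f} [n|n|c|f g _ [f' ? ff'] gab [g' ? gg']|
    f g fab [f' ? ff'] gab [g' ? gg']].
- exists (fun x => flat n.+2 (x - a) + (- n%:R) * flat n.+1 (x - a)).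
    by apply: bump_add; [|apply: bump_algebraZ]; exact: bump_left.
  move=> x.
  have d := @is_derive1_comp _ (flat n) (fun y : R => y - a) x _ _
    (is_derive_flat _ _) (is_derive_shift _ _ (- a)).
  by apply: (is_derive_eq d); rewrite mulr1 mulNr.
- exists (fun x => -1 * (flat n.+2 (b - x) + (- n%:R) * flat n.+1 (b - x))).
    by apply: bump_algebraZ; apply: bump_add; [|apply: bump_algebraZ]; exact: bump_right.
  move=> x.
  have dB : is_derive x 1 (fun y : R => b - y) (-1).
    have d := @is_deriveB _ _ _ (cst b) id x 1 _ _ (is_derive_cst _ _ _) (is_derive_id _ _).
    by apply: (is_derive_eq d); rewrite sub0r.
  have d := @is_derive1_comp _ (flat n) (fun y : R => b - y) x _ _
    (is_derive_flat _ _) dB.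
  by apply: (is_derive_eq d); ring.
- exists (fun=> 0); first exact: bump_cst.
  by move=> x; exact: is_derive_cst.
- exists (fun x => f' x + g' x); first exact: bump_add.
  by move=> x; exact: is_deriveD.
- exists (fun x => f x * g' x + g x * f' x); last by move=> x; exact: is_deriveM.
  by apply: bump_add; exact: bump_mul.
Qed.

Definition bump a b x := flat 0 (x - a) * flat 0 (b - x).
(** As the bump takes its values in the interval from 0 to 1 and is positive
    exactly between [a] and [b], these test functions increase with [n] to the
    indicator of the open interval. *)
Definition plateau a b n x := 1 - (1 - bump a b x) ^+ n.

Lemma flat0_le1 x : flat 0 x <= 1.
Proof.
rewrite /flat; case: ifP => // x0; rewrite mul1r.
by rewrite expR_le1 oppr_le0 invr_ge0 ltW.
Qed.

Lemma bump_itv a b x : 0 <= bump a b x <= 1.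
Proof.
rewrite mulr_ge0 ?flat_ge0//=.
by rewrite mulr_ile1 ?flat_ge0// flat0_le1.
Qed.

Lemma bump_gt0 a b x : (0 < bump a b x) = (x \in `]a, b[).
Proof.
rewrite in_itv/= /bump; apply/idP/andP => [|[ax xb]]; last first.
  by rewrite /flat !subr_gt0 ax xb !mul1r mulr_gt0// expR_gt0.
move=> B; split; rewrite ltNge; apply: contraTN B => ?.
  by rewrite (@flat_le0 _ (x - a)) ?subr_le0// mul0r ltxx.
by rewrite (@flat_le0 _ (b - x)) ?subr_le0// mulr0 ltxx.
Qed.

Lemma bump_eq0 a b x : x \notin `]a, b[ -> bump a b x = 0.
Proof.
move=> xab; apply/eqP; rewrite eq_le; have /andP[-> _] := bump_itv a b x.
by rewrite leNgt bump_gt0 (negbTE xab).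
Qed.

Lemma plateau_itv a b n x : 0 <= plateau a b n x <= 1.
Proof.
have /andP[b0 b1] := bump_itv a b x.
by rewrite /plateau subr_ge0 exprn_ile1 ?subr_ge0//= ?lerBlDr ?lerDl ?exprn_ge0 ?subr_ge0//.
Qed.

Lemma plateau_cvg a b x : plateau a b n x @[n --> \oo] --> (\1_(`]a, b[%classic) x : R).
Proof.
rewrite indicE mem_setE; have [xab|xab] := boolP (x \in _); last first.
  rewrite (_ : (fun _ => _) = cst 0); first exact: cvg_cst.
  by apply/funext => n; rewrite /plateau bump_eq0 ?subr0 ?expr1n ?subrr//.
rewrite -[X in _ --> X]subr0; apply: cvgB; first exact: cvg_cst.
apply: cvg_expr; rewrite ger0_norm ?subr_ge0; last by have /andP[] := bump_itv a b x.
by rewrite gtrBl bump_gt0.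
Qed.

Lemma plateau_C0inf a b n : 0 < a -> b < 1 -> C0inf (plateau a b n).
Proof.
move=> a0 b1; split; last first.
  exists a, b; split => // x xab; rewrite /plateau bump_eq0 ?subr0 ?expr1n ?subrr//.
  by apply: contra xab; apply: subset_itv_oo_cc.
apply: (@bump_algebra_smooth a b).
have B1 : bump_algebra a b (fun x => 1 + -1 * bump a b x).
  apply: bump_add; first exact: bump_cst.
  by apply: bump_algebraZ; apply: bump_mul; [exact: bump_left|exact: bump_right].
have Bn : bump_algebra a b (fun x => (1 + -1 * bump a b x) ^+ n).
  elim: n => [|n IHn]; first exact: bump_cst.
  have -> : (fun x => (1 + -1 * bump a b x) ^+ n.+1) =
    (fun x => (1 + -1 * bump a b x) * (1 + -1 * bump a b x) ^+ n).
    by apply/funext => x; rewrite exprS.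
  exact: bump_mul.
have -> : plateau a b n = (fun x => 1 + -1 * (1 + -1 * bump a b x) ^+ n).
  by apply/funext => x; rewrite /plateau !mulN1r.
by apply: bump_add; [exact: bump_cst|exact: bump_algebraZ].
Qed.

Lemma C0inf_lin f g (c : R) : C0inf f -> C0inf g -> C0inf (fun x => f x + c * g x).
Proof.
move=> [sf [a [b [a0 b1 f0]]]] [sg [a' [b' [a'0 b'1 g0]]]].
split; first exact: smooth_lin.
exists (Num.min a a'), (Num.max b b'); split; rewrite ?lt_min ?gt_max ?a0 ?b1//.
move=> x; rewrite in_itv/= ge_min le_max negb_and !negb_or => x0.
rewrite f0 ?g0 ?mulr0 ?addr0// in_itv/= negb_and.
  by move: x0 => /orP[/andP[_ ->]//|/andP[_ ->]]; rewrite orbT.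
by move: x0 => /orP[/andP[->]//|/andP[-> _]]; rewrite orbT.
Qed.

Lemma C0inf0 : C0inf (fun=> 0 : R).
Proof.
split; last by exists (1/2), (1/2); split => //; rewrite ?ltr_pdivrMr// ?mul1r ?ltr1n.
by apply: (@bump_algebra_smooth 0 1); exact: bump_cst.
Qed.

Lemma C0infZ f (c : R) : C0inf f -> C0inf (fun x => c * f x).
Proof.
move=> Cf; have := C0inf_lin c C0inf0 Cf.
by under [X in C0inf X -> _]funext do rewrite add0r.
Qed.

Lemma C0inf_derive1 f : C0inf f -> C0inf (derive1 f).
Proof.
move=> [sf [a [b [a0 b1 f0]]]]; split; first exact: smooth_derive1.
exists a, b; split => // x xab; rewrite derive1E.
have : is_derive x 1 f 0; last by case.
apply: is_derive_near0; have [xa|xa] := ltP x a.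
  near=> y; rewrite f0// in_itv/= negb_and -ltNge; apply/orP; left.
  near: y; exact: lt_nbhsl.
have bx : b < x by move: xab; rewrite in_itv/= xa/= -ltNge.
near=> y; rewrite f0// in_itv/= negb_and -!ltNge; apply/orP; right.
near: y; exact: lt_nbhsr.
Unshelve. all: by end_near. Qed.

End test_functions.

(** * Exchanging the order of integration *)

Section fubini_kernel.
Context d (T : measurableType d) (R : realType) (m : {finite_measure set T -> \bar R}).
Variables (f g : T -> R) (l : T * T -> R) (M : R).
Hypotheses (mf : measurable_fun setT f) (fM : forall x, `|f x| <= M).
Hypotheses (Ig : m.-integrable setT (EFin \o g)).
Hypotheses (ml : measurable_fun setT l) (l01 : forall z, 0 <= l z <= 1).

Let mg : measurable_fun setT g.
Proof. by move: Ig => /integrableP[/measurable_EFinP]. Qed.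

Let Ig2 : (m \x m)%E.-integrable setT (EFin \o (g \o snd)).
Proof.
apply/integrable21ltyP; first exact/measurable_EFinP/measurableT_comp.
rewrite (_ : (\int[m]_y _)%E = \int[m]_y (`|(g y)%:E| * m setT))%E; last first.
  by apply: eq_integral => y _; rewrite /= integral_cst.
move: Ig => /integrableP[_ goo].
rewrite ge0_integralZr//; last by do 2 apply: measurableT_comp => //.
rewrite lte_mul_pinfty//; first exact: integral_ge0.
- by rewrite ge0_fin_numE//; exact: integral_ge0.
- by rewrite -ge0_fin_numE// fin_num_measure.
Qed.

Let k (z : T * T) := f z.1 * (g z.2 * l z).

Let mk : measurable_fun setT k.
Proof.
apply: measurable_funM; first exact: (measurableT_comp mf).
by apply: measurable_funM => //; exact: (measurableT_comp mg).
Qed.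

Let Ik : (m \x m)%E.-integrable setT (EFin \o k).
Proof.
have : (m \x m)%E.-integrable setT (fun z => M%:E * (EFin \o (g \o snd)) z)%E.
  exact: integrableZl.
apply: le_integrable => //; first exact/measurable_EFinP.
move=> z _; rewrite /= lee_fin !normrM.
have /andP[l0 l1] := l01 z; rewrite (ger0_norm l0).
apply: ler_pM => //; first by rewrite mulr_ge0.
  by rewrite (le_trans (fM _))// ler_norm.
by rewrite ler_piMr.
Qed.

Let Igl x : m.-integrable setT (EFin \o (fun t => g t * l (x, t))).
Proof.
apply: le_integrable Ig => //.
  apply/measurable_EFinP; apply: measurable_funM => //.
  by apply: (measurableT_comp ml).
move=> t _; have /andP[l0 l1] := l01 (x, t).
by rewrite /= lee_fin normrM (ger0_norm l0) ler_piMr.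
Qed.

Let Ifl t : m.-integrable setT (EFin \o (fun x => f x * l (x, t))).
Proof.
have : m.-integrable setT (EFin \o cst M) by exact: finite_measure_integrable_cst.
apply: le_integrable => //.
  apply/measurable_EFinP; apply: measurable_funM => //.
  by apply: (measurableT_comp ml).
move=> x _; have /andP[l0 l1] := l01 (x, t).
rewrite /= lee_fin normrM (ger0_norm l0) (le_trans (ler_piMr _ l1))//.
by rewrite (le_trans (fM _))// ler_norm.
Qed.

Let FE : fubini_F m (EFin \o k) =
  EFin \o (fun x => f x * \int[m]_t (g t * l (x, t))).
Proof.
apply/funext => x /=; rewrite EFinM fineK; last exact: (integrable_fin_num _ (Igl x)).
by rewrite -integralZl//; exact: Igl.
Qed.

Let GE : fubini_G m (EFin \o k) =
  EFin \o (fun t => g t * \int[m]_x (f x * l (x, t))).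
Proof.
apply/funext => t /=; rewrite EFinM fineK; last exact: (integrable_fin_num _ (Ifl t)).
rewrite -integralZl//; last exact: Ifl.
by apply: eq_integral => x _; rewrite /k/= mulrCA EFinM.
Qed.

(** Fubini for the kernel [f x * g t * l (x, t)], which is integrable on the
    product because [f] and [l] are bounded and [m] is finite.  Measurability of
    the two iterated integrals is recorded so that they may later be replaced by
    functions that agree with them almost everywhere. *)
Lemma Rintegral_swap :
  [/\ measurable_fun setT (fun x => f x * \int[m]_t (g t * l (x, t))),
      measurable_fun setT (fun t => g t * \int[m]_x (f x * l (x, t))) &
      \int[m]_x (f x * \int[m]_t (g t * l (x, t))) =
      \int[m]_t (g t * \int[m]_x (f x * l (x, t)))].
Proof.
split.
- by apply/measurable_EFinP; rewrite -FE; exact: (@measurable_fubini_F _ _ _ _ _ m m _ Ik).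
- by apply/measurable_EFinP; rewrite -GE; exact: (@measurable_fubini_G _ _ _ _ _ m m _ Ik).
have := congr1 fine (Fubini Ik).
by rewrite -/(fubini_F m (EFin \o k)) -/(fubini_G m (EFin \o k)) FE GE.
Qed.

End fubini_kernel.

(** * Lebesgue measure on the unit interval and the fundamental lemma *)

Section unit_interval_measure.
Context {R : realType}.
Implicit Types (f g h : R -> R).

Lemma leb01_setT : @leb01 R setT = 1%E.
Proof. by rewrite /leb01/= /mrestr setTI lebesgue_measure_itv/= lte_fin ltr01 oppr0 adde0. Qed.

Lemma measurable01 : measurable (`]0, 1[%classic : set (measurableTypeR R)).
Proof. exact: measurable_itv. Qed.

Lemma mu01_fin : (mu (`]0%R, 1%R[%classic : set (measurableTypeR R)) < +oo)%E.
Proof. by rewrite lebesgue_measure_itv/= lte_fin ltr01 ltry. Qed.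

(** The same measure as [leb01], packaged with the finiteness that the
    theorem of Fubini asks for. *)
Definition fleb01 : {finite_measure set (measurableTypeR R) -> \bar R} :=
  mfrestr measurable01 mu01_fin.

Lemma integral_fleb01 (f : R -> \bar R) :
  (\int[leb01]_x f x = \int[fleb01]_x f x)%E.
Proof. exact: eq_measure_integral. Qed.

Lemma ae01_impl (P Q : R -> Prop) : (forall x, P x -> Q x) ->
  {ae @leb01 R, forall x, P x} -> {ae @leb01 R, forall x, Q x}.
Proof.
move=> PQ [N [mN N0 PN]]; exists N; split => // x nQx.
by apply: PN => Px; apply: nQx; exact: PQ.
Qed.

Lemma ae01_and (P Q : R -> Prop) : {ae @leb01 R, forall x, P x} ->
  {ae @leb01 R, forall x, Q x} -> {ae @leb01 R, forall x, P x /\ Q x}.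
Proof.
by move=> Px Qx; apply: (@filterI _ _ (ae_filter_ringOfSetsType (@leb01 R))).
Qed.

Lemma ae01_all (P : R -> Prop) : (forall x, P x) -> {ae @leb01 R, forall x, P x}.
Proof. by move=> Px; exists set0; split => // x /=; exact. Qed.

Lemma leb01_fin_num : @leb01 R setT \is a fin_num.
Proof. by rewrite leb01_setT. Qed.

Lemma ae_leb01 (P : set R) : {ae mu, forall x, P x} -> {ae @leb01 R, forall x, P x}.
Proof.
move=> [N [mN N0 PN]]; exists N; split => //.
apply/eqP; rewrite -measure_le0 -N0 /leb01/= /mrestr.
by apply: le_measure; rewrite ?inE//; exact: measurableI.
Qed.

Lemma ae_in01 : {ae @leb01 R, forall x, x \in `]0, 1[}.
Proof.
exists (~` (`]0, 1[%classic : set (measurableTypeR R))); split => //.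
- by apply: measurableC; exact: measurable_itv.
- rewrite /leb01/= /mrestr [X in lebesgue_measure X](_ : _ = set0) ?measure0//.
  by rewrite setICl.
Qed.

Lemma ae01_itv (P : R -> Prop) : (forall x, 0 < x -> x < 1 -> P x) ->
  {ae @leb01 R, forall x, P x}.
Proof.
move=> P01; move: ae_in01; apply: ae01_impl => x; rewrite in_itv/= => /andP[].
exact: P01.
Qed.

(** Norms are integrals for the restricted measure, while primitives and the
    fundamental theorem of calculus concern integrals over intervals. *)
Lemma integral_leb01 (f : R -> \bar R) : measurableR f ->
  (\int[leb01]_x f x = \int[mu]_(x in `]0%R, 1%R[) f x)%E.
Proof.
move=> mf; transitivity (\int[@leb01 R]_(x in `]0%R, 1%R[) f x)%E; last first.
  apply: eq_measure_integral => A mA A01.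
  by rewrite /leb01/= /mrestr setIidl.
rewrite [RHS]integral_mkcond; apply: ae_eq_integral => //.
- apply: (measurable_restrictT f measurable01).1; exact: measurable_funS mf.
- by move: ae_in01; apply: ae01_impl => x x01 _; rewrite patchE mem_setE x01.
Qed.

Lemma integrable_leb01 f : integrable01 f <->
  measurableR f /\ mu.-integrable `]0, 1[ (EFin \o f).
Proof.
split=> [/integrableP[mf foo]|[mf /integrableP[_ foo]]].
  split; first exact/measurable_EFinP.
  apply/integrableP; split; first exact: measurable_funTS.
  by rewrite -integral_leb01//; exact: measurableT_comp.
apply/integrableP; split; first exact/measurable_EFinP.
by rewrite integral_leb01//; do 2 apply: measurableT_comp => //.
Qed.

Lemma Rintegral_leb01 f : measurableR f ->
  \int[leb01]_x f x = \int[mu]_(x in `]0, 1[) f x.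
Proof. by move=> mf; rewrite /Rintegral integral_leb01//; exact/measurable_EFinP. Qed.

Lemma C0inf_cont f : C0inf f -> continuous f.
Proof. exact: (@C0inf_continuous _ 0). Qed.

Lemma C0inf_measurable f : C0inf f -> measurableR f.
Proof. by move=> /C0inf_cont; exact: continuous_measurable_fun. Qed.

(** Elements of H, as well as test functions, have this shape. *)
Lemma within01_bounded h : {within `[0, 1], continuous h} ->
  (forall x, x \notin `[0, 1] -> h x = 0) -> exists M : R, forall x, `|h x| <= M.
Proof.
move=> ch h0.
have /compact_bounded[M [_ /(_ (M + 1)) Mh]] : compact (h @` `[0, 1]).
  by apply: continuous_compact; last exact: segment_compact.
have {}Mh x : x \in `[0, 1] -> `|h x| <= M + 1.
  by move=> x01; apply: Mh; [rewrite ltrDl|exists x].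
exists `|M + 1| => x; have [x01|x01] := boolP (x \in `[0, 1]).
  by rewrite (le_trans (Mh _ x01))// ler_norm.
by rewrite h0// normr0.
Qed.

Lemma C0inf_bounded f : C0inf f -> exists M, forall x, `|f x| <= M.
Proof.
move=> Cf; have [_ [a [b [a0 b1 f0]]]] := Cf; apply: within01_bounded.
  by apply: continuous_subspaceT => x; exact: C0inf_cont.
move=> x x01; apply: f0; apply: contra x01; rewrite !in_itv/= => /andP[ax xb].
by rewrite (le_trans (ltW a0) ax) (le_trans xb (ltW b1)).
Qed.

Lemma integrable_bddM (m f : R -> R) (M : R) : measurableR m ->
  {ae @leb01 R, forall x, `|m x| <= M} ->
  integrable01 f ->
  integrable01 (fun x => m x * f x).
Proof.
move=> mm mM If; move: (If) => /integrableP[/measurable_EFinP mf _].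
have mmf : measurableR (fun x => m x * f x).
  exact: measurable_funM.
apply/integrableP; split; first exact/measurable_EFinP.
have : (@leb01 R).-integrable setT (fun x => `|M|%:E * (EFin \o f) x)%E.
  exact: integrableZl.
move=> /integrableP[_]; apply: le_lt_trans.
apply: ae_ge0_le_integral => //.
- by do 2 apply: measurableT_comp => //.
- by apply: measurableT_comp => //; apply: measurable_funeM; exact/measurable_EFinP.
move: mM; apply: ae01_impl => x mM _; rewrite /= lee_fin !normrM normr_id.
by rewrite ler_wpM2r// (le_trans mM)// ler_norm.
Qed.

Lemma C0inf_integrableM (f phi : R -> R) : C0inf phi ->
  integrable01 f ->
  integrable01 (fun x => f x * phi x).
Proof.
move=> Cphi If; have [M phiM] := C0inf_bounded Cphi.
rewrite (_ : (fun x => f x * phi x) = (fun x => phi x * f x)); last first.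
  by apply/funext => x; rewrite mulrC.
apply: (@integrable_bddM _ _ M) => //; first exact: C0inf_measurable.
exact: ae01_all.
Qed.

Lemma integrable_bdd (m : R -> R) (M : R) : measurableR m ->
  {ae @leb01 R, forall x, `|m x| <= M} ->
  integrable01 m.
Proof.
move=> mm mM; have := @integrable_bddM m (fun=> 1) M mm mM.
rewrite (_ : (fun x => m x * 1) = m); last by apply/funext => x; rewrite mulr1.
apply; apply: measurable_bounded_integrable => //; first by rewrite leb01_setT ltry.
by exists 1; split => // y y1 x _ /=; rewrite normr1 ltW.
Qed.

Lemma C0inf_integrable (phi : R -> R) : C0inf phi ->
  integrable01 phi.
Proof.
move=> Cphi; have [M phiM] := C0inf_bounded Cphi.
apply: (@integrable_bdd _ M); [exact: C0inf_measurable|exact: ae01_all].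
Qed.

Lemma eq_Rintegral_ae f g : measurableR f -> measurableR g ->
  {ae @leb01 R, forall x, f x = g x} ->
  \int[leb01]_x f x = \int[leb01]_x g x.
Proof.
move=> mf mg fg; rewrite /Rintegral; congr fine; apply: ae_eq_integral => //.
- exact/measurable_EFinP.
- exact/measurable_EFinP.
- by move: fg; apply: ae01_impl => x -> _.
Qed.

Lemma Rintegral_lin f g (r : R) : integrable01 f -> integrable01 g ->
  \int[leb01]_x (f x + r * g x) = \int[leb01]_x f x + r * \int[leb01]_x g x.
Proof.
move=> If Ig; have Irg := integrableZl measurableT r Ig.
by rewrite (RintegralD measurableT If Irg) (RintegralZl _ measurableT Ig).
Qed.

(** Testing with plateaus and letting them increase to the indicator of the
    interval, by dominated convergence. *)
Lemma tested_itv h a b : 0 < a -> b < 1 ->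
  integrable01 h ->
  (forall phi, C0inf phi -> (forall x, 0 <= phi x) -> 0 <= \int[leb01]_x (h x * phi x)) ->
  0 <= \int[mu]_(x in `]a, b[) h x.
Proof.
move=> a0 b1 Ih h0; have [mh Ih01] := (integrable_leb01 h).1 Ih.
have mh1 : measurableR (fun x => h x * \1_(`]a, b[) x).
  exact: measurable_funM.
have [_ _ cvgE] : [/\ (@leb01 R).-integrable setT (fun x => (h x * \1_(`]a, b[) x)%:E),
   [sequence \int[leb01]_x `|(h x * plateau a b n x)%:E -
     (h x * \1_(`]a, b[) x)%:E|]_n @ \oo --> 0%E &
   [sequence \int[leb01]_x (h x * plateau a b n x)%:E]_n @ \oo -->
     \int[leb01]_x (h x * \1_(`]a, b[) x)%:E]%E.
  apply: (@dominated_convergence _ _ _ (@leb01 R) setT measurableT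
    (fun n x => (h x * plateau a b n x)%:E) (fun x => (h x * \1_(`]a, b[) x)%:E)
    (fun x => `|h x|%:E)).
  - by move=> n; exact: measurable_int _ (C0inf_integrableM (plateau_C0inf n a0 b1) Ih).
  - exact/measurable_EFinP.
  - apply: ae01_all => x _; apply: cvg_EFin.
      by apply: nearW.
    by apply: cvgM; [exact: cvg_cst|exact: plateau_cvg].
  - exact: integrable_norm.
  - apply: ae01_all => x n _; rewrite lee_fin normrM ler_piMr//.
    by have /andP[? ?] := plateau_itv a b n x; rewrite ger0_norm.
have : (0 <= \int[leb01]_x (h x * \1_(`]a, b[) x)%:E)%E.
  rewrite -(cvg_lim _ cvgE)//; apply: lime_ge; first by apply/cvg_ex; eexists; exact: cvgE.
  apply: nearW => n /=.
  have In := C0inf_integrableM (plateau_C0inf n a0 b1) Ih.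
  rewrite -[leRHS]fineK ?lee_fin; last exact: integrable_fin_num.
  apply: h0; first exact: plateau_C0inf.
  by move=> x; have /andP[] := plateau_itv a b n x.
rewrite integral_leb01; last exact/measurable_EFinP.
move=> I0; apply: fine_ge0; rewrite /= in I0.
have -> : `]a, b[%classic = `]0, 1[%classic `&` `]a, b[%classic.
  rewrite setIidr// => x /=; rewrite !in_itv/= => /andP[ax xb].
  by rewrite (lt_trans a0 ax) (lt_trans xb b1).
move: I0; congr (0 <= _)%E; rewrite [RHS]integral_mkcondr.
apply: eq_integral => x _.
by rewrite patchE indicE; case: ifPn => _; rewrite ?mulr1 ?mulr0.
Qed.

(** Fundamental lemma of the calculus of variations, in the form of a sign
    condition.  By [tested_itv] the primitive of [h] is nondecreasing inside the
    interval, and by Lebesgue differentiation its derivative is [h] a.e. *)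
Lemma tested_ge0 h : integrable01 h ->
  (forall phi, C0inf phi -> (forall x, 0 <= phi x) -> 0 <= \int[leb01]_x (h x * phi x)) ->
  {ae @leb01 R, forall x, 0 <= h x}.
Proof.
move=> Ih h0; have [mh Ih01] := (integrable_leb01 h).1 Ih.
(* extended by zero, so that the primitive may start at -oo *)
pose k := h \_ `]0, 1[.
have Ik : mu.-integrable setT (EFin \o k).
  by rewrite /k -restrict_EFin; exact: (integrable_mkcond _ measurable01).1.
pose F x := \int[mu]_(t in `]-oo, x]) k t.
have IkS (A : set R) : measurable A -> mu.-integrable A (EFin \o k).
  by move=> mA; apply: integrableS Ik.
have FB x y : 0 < x -> x <= y -> y < 1 -> 0 <= F y - F x.
  move=> x0 xy y1; rewrite /F Rintegral_itvB ?bnd_simp//; last exact: IkS.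
  rewrite -Rintegral_itv_bndo_bndc; last exact: IkS.
  have := @tested_itv h x y x0 y1 Ih h0; congr (0 <= _).
  apply: eq_Rintegral => t; rewrite inE/= in_itv/= => /andP[xt ty].
  rewrite /k patchE mem_setE in_itv/=.
  by rewrite (lt_trans x0 xt) (lt_trans ty y1).
have := @FTC1Ny _ k (fun y => IkS _ (measurable_itv _)) (integrable_locally measurable01 Ih01).
move=> /ae_leb01 aeF; have := ae01_and aeF ae_in01.
apply: ae01_impl => x [[dF F'] x01].
have <- : k x = h x by rewrite /k patchE mem_setE x01.
rewrite -F' derive1E.
have /andP[x0 x1] : 0 < x < 1 by move: x01; rewrite in_itv.
rewrite /derive; apply: limr_ge; first exact: dF.
have N0 : \forall t \near (0 : R)^', 0 < t + x < 1.
  have tx : (t + x) @[t --> (0 : R)^'] --> x.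
    rewrite -[X in _ --> X]add0r; apply: cvgD; last exact: cvg_cst.
    exact: cvg_within.
  by near=> t; apply/andP; split; near: t; [exact: (cvgr_gt _ tx)|exact: (cvgr_lt _ tx)].
apply: filterS N0 => t /andP[tx0 tx1].
rewrite /= /GRing.scale/= mulr1.
have [t0|t0] := leP 0 t.
  by rewrite mulr_ge0 ?invr_ge0// FB// lerDr.
by rewrite nmulr_rge0 ?invr_lt0// -oppr_ge0 opprB FB// gerDr ltW.
Unshelve. all: by end_near. Qed.

Lemma tested_eq0 h : integrable01 h ->
  (forall phi, C0inf phi -> \int[leb01]_x (h x * phi x) = 0) ->
  {ae @leb01 R, forall x, h x = 0}.
Proof.
move=> Ih h0.
have IN : integrable01 (fun x => -1 * h x).
  by have := integrableZl measurableT (-1) Ih.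
have h1 : {ae @leb01 R, forall x, 0 <= h x}.
  by apply: tested_ge0 => // phi Cphi _; rewrite h0.
have h2 : {ae @leb01 R, forall x, 0 <= -1 * h x}.
  apply: tested_ge0 => // phi Cphi _.
  under eq_Rintegral do rewrite -mulrA.
  by rewrite (RintegralZl _ measurableT (C0inf_integrableM Cphi Ih)) h0// mulr0.
have := ae01_and h1 h2; apply: ae01_impl => x [hx]; rewrite mulN1r oppr_ge0 => hx'.
by apply/eqP; rewrite eq_le hx hx'.
Qed.

End unit_interval_measure.

(** * Primitives and the du Bois-Reymond lemma *)

Section primitives.
Context {R : realType}.
Implicit Types (f g h u v phi : R -> R).

Lemma integrable01_measurable f : integrable01 f -> measurableR f.
Proof. by move=> /integrable_leb01[]. Qed.

Lemma integrable01_cc f : integrable01 f -> mu.-integrable `[0, 1] (EFin \o f).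
Proof.
move=> /integrable_leb01[mf /integrableP[_ foo]]; apply/integrableP; split.
  by apply/measurable_EFinP; exact: measurable_funTS.
rewrite integral_itv_bndoo//.
by do 2 apply: measurableT_comp => //; exact: measurable_funTS.
Qed.

Lemma Rintegral_bndoo f (a b : R) (b0 b1 : bool) : measurableR f ->
  \int[mu]_(x in [set` Interval (BSide b0 a) (BSide b1 b)]) f x =
  \int[mu]_(x in `]a, b[) f x.
Proof.
move=> mf; rewrite /Rintegral integral_itv_bndoo//.
by apply/measurable_EFinP; exact: measurable_funTS.
Qed.

Lemma measurable_indic_lt (x : R) : measurableR (fun t => (t < x)%R%:R : R).
Proof.
rewrite (_ : (fun t => _) = \1_(`]-oo, x[%classic)); last first.
  by apply/funext => t; rewrite indicE mem_setE in_itv.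
exact: measurable_indic.
Qed.

Lemma measurable_indic_gt (x : R) : measurableR (fun t => (x < t)%R%:R : R).
Proof.
rewrite (_ : (fun t => _) = \1_(`]x, +oo[%classic)); last first.
  by apply/funext => t; rewrite indicE mem_setE in_itv/= andbT.
exact: measurable_indic.
Qed.

(** This and [primitiveBE] turn primitives into integrals against a kernel
    over the whole space, the form in which [Rintegral_swap] exchanges them. *)
Lemma primitiveE f x : 0 <= x <= 1 -> measurableR f ->
  primitive f x = \int[leb01]_t (f t * (t < x)%R%:R).
Proof.
move=> /andP[x0 x1] mf.
have mfx : measurableR (fun t => f t * (t < x)%R%:R).
  apply: measurable_funM => //; exact: measurable_indic_lt.
rewrite Rintegral_leb01// /primitive Rintegral_bndoo//.
have -> : `]0, x[%classic = `]0, 1[%classic `&` `]0, x[%classic.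
  rewrite setIidr// => y /=; rewrite !in_itv/= => /andP[-> yx]/=.
  exact: lt_le_trans x1.
rewrite Rintegral_mkcondr; apply: eq_Rintegral => t.
rewrite patchE !mem_setE !in_itv/= => /andP[-> _]/=.
by case: ifPn => _; rewrite ?mulr1 ?mulr0.
Qed.

Lemma primitiveBE f x : 0 <= x <= 1 -> integrable01 f ->
  primitive f 1 - primitive f x = \int[leb01]_t (f t * (x < t)%R%:R).
Proof.
move=> x01 If; have /andP[x0 x1] := x01; have mf := integrable01_measurable If.
have mfx : measurableR (fun t => f t * (x < t)%R%:R).
  apply: measurable_funM => //; exact: measurable_indic_gt.
rewrite /primitive Rintegral_itvB ?bnd_simp//; last exact: integrable01_cc.
rewrite Rintegral_leb01// Rintegral_bndoo//.
have -> : `]x, 1[%classic = `]0, 1[%classic `&` `]x, 1[%classic.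
  rewrite setIidr// => y /=; rewrite !in_itv/= => /andP[xy ->]/=.
  by rewrite andbT; exact: le_lt_trans xy.
rewrite Rintegral_mkcondr; apply: eq_Rintegral => t.
rewrite patchE !mem_setE !in_itv/= => /andP[_ ->]/=; rewrite andbT.
by case: ifPn => _; rewrite ?mulr1 ?mulr0.
Qed.

Lemma within_continuous_primitive g : integrable01 g ->
  {within `[0, 1], continuous (primitive g)}.
Proof.
by move=> /integrable01_cc; exact: parameterized_integral_continuous.
Qed.

(** The representative, on the whole line, of the element of H whose weak
    derivative is [g]: the integral of [g] starting from 1, extended by zero. *)
Definition antider g := (fun x => primitive g x - primitive g 1) \_ `[0, 1].

Lemma antiderE g x : 0 <= x <= 1 -> antider g x = primitive g x - primitive g 1.
Proof. by move=> x01; rewrite /antider patchE mem_setE in_itv/= x01. Qed.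

Lemma within_continuous_antider g : integrable01 g ->
  {within `[0, 1], continuous (antider g)}.
Proof.
move=> Ig; have cg := within_continuous_primitive Ig.
apply: (@subspace_eq_continuous _ _ _ (fun x => primitive g x - primitive g 1)).
  by move=> x; rewrite mem_setE in_itv/= => x01; exact/esym/antiderE.
by move=> x; apply: cvgB; [exact: cg|exact: cvg_cst].
Qed.

Lemma antider_out g x : x \notin `[0, 1] -> antider g x = 0.
Proof. by move=> x01; rewrite /antider patchE mem_setE (negbTE x01). Qed.

Lemma within01_measurable h : {within `[0, 1], continuous h} ->
  (forall x, x \notin `[0, 1] -> h x = 0) -> measurableR h.
Proof.
move=> ch h0; rewrite (_ : h = h \_ `[0, 1]); last first.
  by apply/funext => x; rewrite patchE mem_setE; case: ifPn => // /h0.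
apply: (measurable_restrictT _ _).1 => //.
exact: subspace_continuous_measurable_fun.
Qed.

Lemma antider_measurable g : integrable01 g -> measurableR (antider g).
Proof.
move=> Ig; apply: within01_measurable; last exact: antider_out.
exact: within_continuous_antider.
Qed.

Lemma antider_bounded g : integrable01 g -> exists M : R, forall x, `|antider g x| <= M.
Proof.
move=> Ig; apply: within01_bounded; last exact: antider_out.
exact: within_continuous_antider.
Qed.

(** To the left of the support the primitive vanishes, also on the negative
    half-line where its domain of integration is empty; elsewhere this is the
    fundamental theorem of calculus. *)
Lemma is_derive_primitive f (x : R) : C0inf f -> is_derive x 1 (primitive f) (f x).
Proof.
move=> Cf; have [_ [a [b [a0 b1 f0]]]] := Cf.
have fa y : y < a -> f y = 0.
  by move=> ya; rewrite f0// in_itv/= leNgt ya.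
have [xa|ax] := ltP x a.
  rewrite fa//; apply: is_derive_near0; near=> y.
  rewrite /primitive (@eq_Rintegral _ _ _ _ _ (cst 0)).
    by rewrite Rintegral_cst// mul0r.
  move=> t; rewrite inE/= in_itv/= => /andP[_ ty]; rewrite fa//.
  apply: le_lt_trans ty _; near: y; exact: lt_nbhsl.
have x0 : 0 < x by exact: lt_le_trans ax.
have If : mu.-integrable `[0, x + 1] (EFin \o f).
  apply: continuous_compact_integrable; first exact: segment_compact.
  by apply: continuous_subspaceT => y; exact: C0inf_cont.
have cx : {for x, continuous f} by exact: C0inf_cont.
have xx1 : x < x + 1 by rewrite ltrDl.
(* the upper bound x + 1 only provides room to the right of x *)
have [dp <-] : derivable (primitive f) x 1 /\ derive1 (primitive f) x = f x.
  exact: (@continuous_FTC1_closed _ f 0 x (x + 1) xx1 If x0 cx).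
by rewrite derive1E; exact/derivableP.
Unshelve. all: by end_near. Qed.

Lemma primitive_continuous f : C0inf f -> continuous (primitive f).
Proof.
move=> Cf x; apply: differentiable_continuous; apply/derivable1_diffP.
by have [] := is_derive_primitive x Cf.
Qed.

Lemma primitive_measurable f : C0inf f -> measurableR (primitive f).
Proof. by move=> Cf; apply: continuous_measurable_fun; exact: primitive_continuous. Qed.

(** Integration by parts without regularity of [g]: up to sign, both sides are the
    double integral of [f x * g t] over [x < t]. *)
Lemma Rintegral_antider f g : C0inf f -> integrable01 g ->
  \int[leb01]_x (f x * antider g x) = - \int[leb01]_t (g t * primitive f t).
Proof.
move=> Cf Ig; have mf := C0inf_measurable Cf; have mg := integrable01_measurable Ig.
have [M fM] := C0inf_bounded Cf.
pose l (z : R * R) : R := (z.1 < z.2)%R%:R.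
have l01 z : 0 <= l z <= 1 by rewrite /l; case: (_ < _); rewrite ?lexx ler01.
have ml : measurable_fun [set: measurableTypeR R * measurableTypeR R] l.
  pose MR := measurableTypeR R.
  have mlt := @measurable_fun_ltr _ _ _ setT _ _
    (@measurable_fst _ _ MR MR) (@measurable_snd _ _ MR MR).
  have := mlt measurableT [set true] I; rewrite setTI => mA.
  rewrite (_ : l = \1_((fun z : MR * MR => z.1 < z.2) @^-1` [set true])).
    exact: measurable_indic.
  apply/funext => z; rewrite indicE /l; congr ((nat_of_bool _)%:R).
  by apply/idP/idP; rewrite inE.
have Rf h : \int[leb01]_x h x = \int[fleb01]_x h x by rewrite /Rintegral integral_fleb01.
have Ig' : (@fleb01 R).-integrable setT (EFin \o g).
  by move/integrableP : (Ig) => [? ?]; apply/integrableP; split.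
have [mF mG E] := Rintegral_swap mf fM Ig' ml l01.
have [A gA] := antider_bounded Ig.
pose h x := f x * antider g x.
have Ih : integrable01 h.
  apply: (integrable_bddM mf (ae01_all fM)).
  exact: (integrable_bdd (antider_measurable Ig) (ae01_all gA)).
have -> : \int[leb01]_x h x = - \int[leb01]_x (-1 * h x).
  by rewrite (RintegralZl _ measurableT Ih) mulN1r opprK.
congr (- _); transitivity (\int[leb01]_x (f x * \int[fleb01]_t (g t * l (x, t)))).
  apply: eq_Rintegral_ae; [|exact: mF|].
    by apply: measurable_funM; [exact: measurable_cst|exact: integrable01_measurable].
  apply: ae01_itv => x /ltW x0 /ltW x1.
  have x01 : 0 <= x <= 1 by rewrite x0.
  rewrite /h (antiderE g x01) mulN1r -mulrN opprB -Rf; congr (_ * _).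
  exact: primitiveBE.
rewrite Rf E -Rf; apply: eq_Rintegral_ae; first exact: mG.
  by apply: measurable_funM; [exact: mg|exact: primitive_measurable].
apply: ae01_itv => x /ltW x0 /ltW x1.
by rewrite -Rf primitiveE ?x0.
Qed.

Lemma primitive0 f : primitive f 0 = 0.
Proof. by rewrite /primitive set_itv1 Rintegral_set1. Qed.

Lemma C0inf_0 f : C0inf f -> f 0 = 0.
Proof. by move=> [_ [a [b [a0 b1 f0]]]]; rewrite f0// in_itv/= leNgt a0. Qed.

Lemma primitive_derive1 phi x : C0inf phi -> primitive (derive1 phi) x = phi x.
Proof.
move=> Cphi; pose d := (primitive (derive1 phi) - phi : R -> R).
have d0 (y : R) : is_derive y 1 d 0.
  have dphi : is_derive y 1 phi (derive1 phi y).
    by rewrite derive1E; apply/derivableP; have [s _] := Cphi; exact: (s 0%N).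
  have dp := is_derive_primitive y (C0inf_derive1 Cphi).
  by apply: (is_derive_eq (is_deriveB dp dphi)); rewrite subrr.
have : d x = d 0 by apply: is_derive_0_is_cst.
have -> : d x = primitive (derive1 phi) x - phi x by [].
have -> : d 0 = primitive (derive1 phi) 0 - phi 0 by [].
by rewrite primitive0 C0inf_0// subr0 => /eqP; rewrite subr_eq0 => /eqP.
Qed.

(** Otherwise the constant -1, integrated against any test function, would give
    0, and so would be nonnegative a.e. by [tested_ge0]. *)
Lemma exists_test_Rintegral_neq0 : exists2 phi : R -> R, C0inf phi & \int[leb01]_x phi x != 0.
Proof.
apply: contrapT => nophi.
have phi0 (phi : R -> R) : C0inf phi -> \int[leb01]_x phi x = 0.
  by move=> Cphi; apply: contrapT => /eqP phi0; apply: nophi; exists phi.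
have : {ae @leb01 R, forall x, 0 <= (fun=> -1) x :> R}.
  apply: tested_ge0.
    apply: (@integrable_bdd _ _ 1); first exact: measurable_cst.
    by apply: ae01_all => x; rewrite normrN1.
  move=> phi Cphi _.
  by rewrite (RintegralZl _ measurableT (C0inf_integrable Cphi)) phi0// mulr0.
move=> [N [mN N0 PN]].
suff : @leb01 R setT = 0%E by rewrite leb01_setT => /eqP; rewrite onee_eq0.
rewrite (_ : setT = N)//; apply/seteqP; split => // x _; apply: PN => /=.
by rewrite ler0N1.
Qed.

(** The primitive is constant to the right of the support, and the vanishing
    integral makes this constant 0. *)
Lemma primitive_C0inf f : C0inf f -> \int[leb01]_x f x = 0 -> C0inf (primitive f).
Proof.
move=> Cf If0; have [sf [a [b [a0 b1 f0]]]] := Cf; split.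
  by apply: (@smooth_antiderivative _ _ f) => // x; exact: is_derive_primitive.
have If := C0inf_integrable Cf.
have mf := C0inf_measurable Cf.
have p1 : primitive f 1 = 0.
  by rewrite /primitive Rintegral_bndoo// -Rintegral_leb01.
exists a, b; split => // x; rewrite in_itv/= negb_and -!ltNge => xab.
have [xa|xa] := ltP x a.
  rewrite /primitive (@eq_Rintegral _ _ _ _ _ (cst 0)).
    by rewrite Rintegral_cst// mul0r.
  move=> t; rewrite inE/= in_itv/= => /andP[_ tx].
  by rewrite f0// in_itv/= leNgt (le_lt_trans tx xa).
have bx : b < x by move: xab; rewrite ltNge xa.
have pE y z : b < y -> y <= z -> 0 <= y -> primitive f z = primitive f y.
  move=> by_ yz y0; apply/eqP; rewrite -subr_eq0; apply/eqP.
  rewrite /primitive Rintegral_itvB ?bnd_simp//.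
    rewrite (@eq_Rintegral _ _ _ _ _ (cst 0)).
      by rewrite Rintegral_cst// mul0r.
    move=> t; rewrite inE/= in_itv/= => /andP[yt _].
    by rewrite f0// in_itv/= (leNgt t) (lt_trans by_ yt) andbF.
  apply: continuous_compact_integrable; first exact: segment_compact.
  by apply: continuous_subspaceT => w; exact: C0inf_cont.
have [x1|x1] := leP x 1; last by rewrite (pE 1 x) ?ler01// ltW.
by rewrite -(pE x 1)// (le_trans (ltW a0)).
Qed.

Lemma C0inf_antiderivative f : C0inf f -> \int[leb01]_x f x = 0 ->
  exists2 phi : R -> R, C0inf phi & derive1 phi = f.
Proof.
move=> Cf If; exists (primitive f); first exact: primitive_C0inf.
apply/funext => x; rewrite derive1E; have := is_derive_primitive x Cf.
by case.
Qed.

(** Subtracting from a test function the multiple of a fixed one that makes the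
    integral vanish leaves the derivative of a test function, on which [h]
    integrates to 0.  So [h] minus a suitable constant is orthogonal to all test
    functions. *)
Lemma du_Bois_Reymond h : integrable01 h ->
  (forall phi, C0inf phi -> \int[leb01]_x (h x * derive1 phi x) = 0) ->
  exists k, {ae @leb01 R, forall x, h x = k}.
Proof.
move=> Ih h0; have [psi Cpsi psi0] := exists_test_Rintegral_neq0.
set c := \int[leb01]_x psi x in psi0.
pose k := (\int[leb01]_x (h x * psi x)) / c.
exists k.
have Ihk : integrable01 (fun x => h x + (- k)).
  have Ik : integrable01 (fun=> - k).
    apply: (@integrable_bdd _ _ `|k|); first exact: measurable_cst.
    by apply: ae01_all => x; rewrite normrN.
  by have := integrableD measurableT Ih Ik.
suff : {ae @leb01 R, forall x, h x + (- k) = 0}.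
  by apply: ae01_impl => x /eqP; rewrite subr_eq0 => /eqP.
apply: tested_eq0 => // phi Cphi.
have Iphi := C0inf_integrable Cphi; have Ipsi := C0inf_integrable Cpsi.
have Ihphi := C0inf_integrableM Cphi Ih; have Ihpsi := C0inf_integrableM Cpsi Ih.
set d := \int[leb01]_x phi x.
(* theta = phi - (d / c) psi has integral 0, hence is the derivative of Phi *)
have Ctheta := C0inf_lin (- (d / c)) Cphi Cpsi.
have [|Phi CPhi dPhi] := C0inf_antiderivative Ctheta.
  by rewrite Rintegral_lin// -/d -/c mulNr mulfVK// subrr.
have := h0 _ CPhi; rewrite dPhi.
under eq_Rintegral do rewrite mulrDr mulrCA.
rewrite Rintegral_lin// => E.
under eq_Rintegral do rewrite mulrDl.
rewrite Rintegral_lin// -/d; move: E; rewrite /k => E.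
by rewrite -[RHS]E; congr (_ + _); ring.
Qed.

End primitives.

(** * The space H *)

Section H_space.
Context {R : realType}.
Implicit Types (f g h u phi : R -> R) (v : H R).

Lemma Lfun_measurable p f : f \in Lfun (@leb01 R) p -> measurableR f.
Proof. by case/andP; rewrite !inE. Qed.

Lemma Lfun2_integrable f : f \in Lfun (@leb01 R) 2%:E -> integrable01 f.
Proof.
move=> f2; apply/Lfun1_integrable; apply: Lfun_subset12 f2.
exact: leb01_fin_num.
Qed.

Lemma bounded_Lfuny f (M : R) : measurableR f -> {ae @leb01 R, forall x, `|f x| <= M} ->
  f \in Lfun (@leb01 R) +oo%E.
Proof.
move=> mf fM; apply/andP; split; rewrite inE//=.
rewrite /finite_norm unlock leb01_setT lte01.
apply: (@le_lt_trans _ _ M%:E); last exact: ltry.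
by apply/ess_supP; move: fM; apply: ae01_impl => x; rewrite /= lee_fin.
Qed.

Lemma bounded_Lfun2 f (M : R) : measurableR f -> {ae @leb01 R, forall x, `|f x| <= M} ->
  f \in Lfun (@leb01 R) 2%:E.
Proof.
move=> mf fM; apply: (@Lfun_subset _ _ _ _ 2%:E +oo%E) (bounded_Lfuny mf fM).
- by rewrite lee1n.
- exact: leey.
- exact: leb01_fin_num.
- exact: leey.
Qed.

(** This is why [dx], defined by an arbitrary choice, can be computed a.e. from
    any weak derivative. *)
Lemma weak_derivative_uniq u (g h : L2fun (R := R)) :
  weak_derivative u g -> weak_derivative u h -> {ae @leb01 R, forall x, g x = h x}.
Proof.
move=> ug uh; have Ig := Lfun2_integrable (LfunP g); have Ih := Lfun2_integrable (LfunP h).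
have Igh : integrable01 (fun x => g x + -1 * h x).
  by have := integrableD measurableT Ig (integrableZl measurableT (-1) Ih).
suff : {ae @leb01 R, forall x, g x + -1 * h x = 0}.
  by apply: ae01_impl => x; rewrite mulN1r => /eqP; rewrite subr_eq0 => /eqP.
apply: tested_eq0 => // phi Cphi.
under eq_Rintegral do rewrite mulrDl -mulrA.
rewrite Rintegral_lin; [|exact: C0inf_integrableM..].
have eg : \int[leb01]_x (g x * phi x) = \int[leb01]_x (h x * phi x).
  by apply: oppr_inj; rewrite -ug// -uh.
by rewrite eg mulN1r subrr.
Qed.

(** [Rintegral_antider] applied to the derivative of a test function, whose
    primitive is the test function itself. *)
Lemma antider_weak_derivative (g : L2fun (R := R)) : weak_derivative (antider g) g.
Proof.
move=> phi Cphi; under eq_Rintegral do rewrite mulrC.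
rewrite (Rintegral_antider (C0inf_derive1 Cphi) (Lfun2_integrable (LfunP g))).
by congr (- _); apply: eq_Rintegral => x _; rewrite primitive_derive1.
Qed.

(** Surjectivity of the weak derivative from H onto L^2. *)
Lemma antider_inH (g : L2fun (R := R)) : antider g \in (@inH R).
Proof.
have Ig := Lfun2_integrable (LfunP g).
have [M gM] := antider_bounded Ig.
apply/asboolP; split.
- split; last by exists g; exact: antider_weak_derivative.
  exact: bounded_Lfun2 (antider_measurable Ig) (ae01_all gM).
- exact: within_continuous_antider.
- by rewrite antiderE ?lexx ?ler01// subrr.
- exact: antider_out.
Qed.

Lemma H_inP v : [/\ H1 v, {within `[0, 1], continuous (v : R -> R)}, v 1 = 0 &
  forall x, x \notin `[0, 1] -> v x = 0].
Proof. exact/asboolP/(valP v). Qed.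

Lemma dxP v : weak_derivative v (dx v).
Proof.
have [[_ [g vg]] _ _ _] := H_inP v.
by rewrite /dx; case: xgetP => // /(_ g).
Qed.

Lemma dx_uniq v (g : L2fun (R := R)) : weak_derivative v g ->
  {ae @leb01 R, forall x, dx v x = g x}.
Proof. exact: weak_derivative_uniq (dxP v). Qed.

(** A conull set meets every left neighbourhood of 1. *)
Lemma cvg_ae_cst h (k : R) : h x @[x --> 1^'-] --> 0 ->
  {ae @leb01 R, forall x, h x = k} -> k = 0.
Proof.
move=> h0 [N [mN N0 PN]]; apply/eqP; apply: contraT => k0.
have k20 : 0 < `|k| / 2 by rewrite divr_gt0// normr_gt0.
have [e /= e0 he] : \forall x \near 1^'-, `|h x| < `|k| / 2.
  by have /cvgr0Pnorm_lt := h0; exact.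
pose c := Num.max 0 (1 - e).
have c1 : c < 1 by rewrite gt_max ltr01 gtrBl.
(* h is too small on ]c, 1[ to take the value k there *)
have cN : `]c, 1[%classic `<=` N.
  move=> x /=; rewrite in_itv/= gt_max => /andP[/andP[x0 xe] x1]; apply: PN => /= hk.
  have : `|h x| < `|k| / 2.
    by apply: he => //=; rewrite ger0_norm ?subr_ge0 1?ltW// ltrBlDl -ltrBlDr.
  by rewrite hk ltr_pdivlMr// mulr_natr mulr2n gtrDl ltNge normr_ge0.
have : (@leb01 R `]c, 1%R[%classic <= 0)%E by rewrite -N0; apply: le_measure; rewrite ?inE.
rewrite /leb01/= /mrestr setIidl; last first.
  by move=> x /=; rewrite !in_itv/= gt_max => /andP[/andP[-> _] ->].
by rewrite lebesgue_measure_itv/= lte_fin c1 -EFinD lee_fin leNgt subr_gt0 c1.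
Qed.

Lemma within01_cvg1 h : {within `[0, 1], continuous h} -> h x @[x --> 1^'-] --> h 1.
Proof. by move=> /(continuous_within_itvP _ ltr01)[]. Qed.

(** The two sides have the same weak derivative, hence differ by a constant a.e.
    by du Bois-Reymond; both are continuous up to 1 and vanish there, so that
    the constant is 0. *)
Lemma H_antider v : {ae @leb01 R, forall x, v x = antider (dx v) x}.
Proof.
have [[Lv _] cv v1 v0] := H_inP v.
have Iv := Lfun2_integrable Lv; have Idv := Lfun2_integrable (LfunP (dx v)).
have [M wM] := antider_bounded Idv; have mw := antider_measurable Idv.
have Iw := integrable_bdd mw (ae01_all wM).
pose h x := v x + -1 * antider (dx v) x.
have Ih : integrable01 h.
  by have := integrableD measurableT Iv (integrableZl measurableT (-1) Iw).
have [phi Cphi|k hk] := du_Bois_Reymond Ih.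
  have C' := C0inf_derive1 Cphi.
  under eq_Rintegral do rewrite mulrDl -mulrA.
  rewrite Rintegral_lin; [|exact: C0inf_integrableM..].
  rewrite (dxP v Cphi) (antider_weak_derivative (dx v) Cphi).
  by rewrite mulN1r opprK addNr.
have k0 : k = 0.
  apply: (@cvg_ae_cst h) => //; rewrite -[X in _ --> X](_ : h 1 = 0); last first.
    by rewrite /h v1 antiderE ?lexx ?ler01// subrr mulr0 addr0.
  apply: cvgD; first exact: within01_cvg1.
  apply: cvgM; first exact: cvg_cst.
  by apply: within01_cvg1; exact: within_continuous_antider.
move: hk; apply: ae01_impl => x; rewrite k0 /h mulN1r => /eqP.
by rewrite subr_eq0 => /eqP.
Qed.

(** The boundary term at 0 is absent because [primitive f] vanishes there, the
    one at 1 because [v] does. *)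
Lemma Rintegral_H f v : C0inf f ->
  \int[leb01]_x (f x * v x) = - \int[leb01]_x (dx v x * primitive f x).
Proof.
move=> Cf; have [[Lv _] cv v1 v0] := H_inP v.
have Idv := Lfun2_integrable (LfunP (dx v)).
rewrite -(Rintegral_antider Cf Idv); apply: eq_Rintegral_ae.
- by apply: measurable_funM; [exact: C0inf_measurable|exact: Lfun_measurable Lv].
- by apply: measurable_funM; [exact: C0inf_measurable|exact: antider_measurable].
- by have := H_antider v; apply: ae01_impl => x ->.
Qed.

End H_space.

(** * The derivative of a resolvent *)

Section resolvent_formula.
Context {R : realType}.
Implicit Types (f g h phi : R -> R) (u v : H R).

Lemma H_linE (a : R) u v x : (a *: u + v) x = a * u x + v x.
Proof. by []. Qed.

Lemma HnormE u : (Hnorm u)%:E = L2norm (dx u).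
Proof.
rewrite /Hnorm fineK// ge0_fin_numE ?Lnorm_ge0//.
by have /andP[_] := LfunP (dx u); rewrite inE.
Qed.

Lemma H_integrable u : integrable01 u.
Proof. by have [[Lu _] _ _ _] := H_inP u; exact: Lfun2_integrable. Qed.

Lemma dx_integrable u : integrable01 (dx u).
Proof. exact/Lfun2_integrable/LfunP. Qed.

Lemma dx_measurable u : measurableR (dx u).
Proof. exact: integrable01_measurable (dx_integrable u). Qed.

Lemma dx_lin (a : R) u v :
  {ae @leb01 R, forall x, dx (a *: u + v) x = a * dx u x + dx v x}.
Proof.
apply: (@dx_uniq _ (a *: u + v) (a *: dx u + dx v)) => phi Cphi.
have C' := C0inf_derive1 Cphi.
have lin (f g h : R -> R) : integrable01 f -> integrable01 g -> C0inf h ->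
    \int[leb01]_x ((a * f x + g x) * h x) =
    \int[leb01]_x (g x * h x) + a * \int[leb01]_x (f x * h x).
  move=> If Ig Ch; rewrite -Rintegral_lin; [|exact: C0inf_integrableM..].
  by apply: eq_Rintegral => x _; rewrite mulrDl addrC mulrA.
transitivity (\int[leb01]_x ((a * u x + v x) * derive1 phi x)); first by [].
rewrite lin//; [|exact: H_integrable..].
rewrite (dxP u Cphi) (dxP v Cphi) mulrN -opprD; congr (- _).
by rewrite -lin//; exact: dx_integrable.
Qed.

(** Written as [x * (x^2)^(-1)], the inverse becomes a real power of a
    nonnegative number; at 0 both sides are 0. *)
Lemma measurable_inv f : measurableR f -> measurableR (fun x => (f x)^-1).
Proof.
move=> mf; rewrite (_ : (fun x => _) = (fun x => f x * (f x * f x) `^ (-1))).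
  apply: measurable_funM => //.
  apply: (measurableT_comp (measurable_powR _)).
  exact: measurable_funM.
apply/funext => x; rewrite powR_inv1 -?expr2 ?sqr_ge0//.
have [->|f0] := eqVneq (f x) 0; first by rewrite invr0 mul0r.
by rewrite expr2 invfM mulrA divff// mul1r.
Qed.

Lemma primitive_bounded f : integrable01 f ->
  exists M : R, {ae @leb01 R, forall x, `|primitive f x| <= M}.
Proof.
move=> If; have [M fM] := antider_bounded If; exists (M + `|primitive f 1|).
apply: ae01_itv => x /ltW x0 /ltW x1; have x01 : 0 <= x <= 1 by rewrite x0.
have -> : primitive f x = antider f x + primitive f 1 by rewrite antiderE// subrK.
by rewrite (le_trans (ler_normD _ _))// lerD2r.
Qed.

Lemma primitive_Lfun2 f : C0inf f -> primitive f \in Lfun (@leb01 R) 2%:E.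
Proof.
move=> Cf; have [M fM] := primitive_bounded (C0inf_integrable Cf).
exact: bounded_Lfun2 (primitive_measurable Cf) fM.
Qed.

Lemma Lfun2_integrableM f g : f \in Lfun (@leb01 R) 2%:E ->
  g \in Lfun (@leb01 R) 2%:E -> integrable01 (fun x => f x * g x).
Proof. by move=> f2 g2; apply/Lfun1_integrable; exact: Lfun2_mul_Lfun1. Qed.

Section dual.
Variables (f : R -> R).
Hypothesis Cf : C0inf f.

Let Phi (v : H R) := \int[leb01]_x (f x * v x).

Let Phi_lin : scalar Phi.
Proof.
move=> a u v.
have PhiE w : Phi w = \int[leb01]_x (w x * f x).
  by apply: eq_Rintegral => x _; rewrite mulrC.
have If (w : H R) : integrable01 (fun x => w x * f x).
  exact: C0inf_integrableM (H_integrable w).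
rewrite !PhiE [RHS]addrC -(Rintegral_lin a (If v) (If u)).
by apply: eq_Rintegral => x _; rewrite H_linE mulrDl -mulrA addrC.
Qed.

Let Phi_scalar : {scalar H R} := HB.pack Phi (GRing.isLinear.Build _ _ _ _ Phi Phi_lin).

Let Phi_bounded : exists C : R, forall v, `|Phi_scalar v| <= C * Hnorm v.
Proof.
have p2 := primitive_Lfun2 Cf.
(* Cauchy-Schwarz for the integral of dx v * primitive f *)
exists (fine (L2norm (primitive f))) => v.
have If : integrable01 (fun x => dx v x * primitive f x).
  exact: Lfun2_integrableM (LfunP _) p2.
have -> : Phi_scalar v = - \int[leb01]_x (dx v x * primitive f x).
  exact: Rintegral_H.
rewrite normrN -lee_fin EFinM HnormE fineK; last first.
  by rewrite ge0_fin_numE ?Lnorm_ge0//; move: p2 => /andP[_]; rewrite inE.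
have h2 : (2:R)^-1 + 2^-1 = 1 by rewrite [RHS]splitr mul1r.
rewrite muleC; apply: le_trans (hoelder _ (dx_measurable v) (primitive_measurable Cf) _ _ h2) => //.
rewrite Lnorm1 EFin_normr_Rintegral//; apply: le_abse_integral => //.
by apply: measurable_int If.
Qed.

(** By [Rintegral_H] and the Cauchy-Schwarz inequality the functional is bounded
    by the L^2 norm of the primitive of [f], so that it does belong to the dual
    and [in_dual f] is not the default value. *)
Lemma in_dualE v : in_dual f v = \int[leb01]_x (f x * v x).
Proof.
rewrite /in_dual; case: xgetP => [F _ //|/(_ (MkHdual Phi_bounded))].
by case.
Qed.

End dual.

(** The antiderivative of [- F / sigma] solves the variational equation, so that
    [resolvent] is not the default value.  Any solution [w] then satisfies
    [int (sigma w_x + F) v_x = 0] for all [v] in H, in particular when [v_x] is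
    an arbitrary test function. *)
Lemma dx_resolvent (c0 c1 : R) (sigma f : R -> R) : 0 < c0 -> Sigma0 c0 c1 sigma -> C0inf f ->
  {ae @leb01 R, forall x, dx (resolvent sigma (in_dual f)) x =
    - (primitive f x / sigma x)}.
Proof.
move=> c00 [sLf sc] Cf; have ms := Lfun_measurable sLf.
have p2 := primitive_Lfun2 Cf; have mp := primitive_measurable Cf.
have [M pM] := primitive_bounded (C0inf_integrable Cf).
pose G x := - (primitive f x / sigma x).
have mG : measurableR G.
  apply: (measurableT_comp (@oppr_measurable _ _)).
  by apply: measurable_funM => //; exact: measurable_inv.
have GM : {ae @leb01 R, forall x, `|G x| <= `|M| / c0}.
  have := ae01_and pM sc; apply: ae01_impl => x [px /andP[sx _]].
  have sx0 : 0 < sigma x by exact: lt_le_trans sx.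
  rewrite /G normrN normrM normfV (gtr0_norm sx0) ler_pM ?invr_ge0 ?(ltW sx0)//.
    by rewrite (le_trans px)// ler_norm.
  by rewrite lef_pV2.
have G2 := bounded_Lfun2 mG GM.
pose G' : L2fun := Lfun_Sub (lee1n 2 : (1 <= 2%:E)%E) G2.
have sb : {ae @leb01 R, forall x, `|sigma x| <= c1}.
  move: sc; apply: ae01_impl => x /andP[s0 s1].
  by rewrite ger0_norm// (le_trans (ltW c00)).
have ints (w v : H R) : integrable01 (fun x => sigma x * dx w x * dx v x).
  have Iwv := Lfun2_integrableM (LfunP (dx w)) (LfunP (dx v)).
  have := integrable_bddM ms sb Iwv.
  rewrite (_ : (fun x => sigma x * (dx w x * dx v x)) = (fun x => sigma x * dx w x * dx v x))//.
  by apply/funext => x; rewrite mulrA.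
have eqn : forall v : H R, \int[leb01]_x (sigma x * dx (resolvent sigma (in_dual f)) x * dx v x)
    = in_dual f v.
  rewrite /resolvent; case: xgetP => [u _ uP v|].
    exact: uP.
  pose u : H R := MkH (antider_inH G').
  have du : {ae @leb01 R, forall x, dx u x = G x}.
    exact: (@dx_uniq _ u G' (antider_weak_derivative G')).
  move=> /(_ u) /=; case=> v; rewrite in_dualE// Rintegral_H//.
  have Ip : integrable01 (fun x => dx v x * primitive f x).
    exact: Lfun2_integrableM (LfunP _) p2.
  rewrite -mulN1r -(RintegralZl _ measurableT Ip).
  apply: eq_Rintegral_ae.
  - exact: integrable01_measurable.
  - by apply: measurable_funM; [exact: measurable_cst|exact: integrable01_measurable Ip].
  have := ae01_and du sc; apply: ae01_impl => x [-> /andP[sx _]].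
  have sx0 : sigma x != 0 by rewrite gt_eqF// (lt_le_trans c00).
  by rewrite /G mulrN mulrCA mulfV// mulr1 mulNr mulN1r mulrC.
set w := resolvent sigma (in_dual f) in eqn *.
have Isw : integrable01 (fun x => sigma x * dx w x).
  exact: (integrable_bddM ms sb (dx_integrable w)).
have Ip1 : integrable01 (primitive f) by exact: Lfun2_integrable.
have Ih : integrable01 (fun x => sigma x * dx w x + 1 * primitive f x).
  by have := integrableD measurableT Isw (integrableZl measurableT 1 Ip1).
have h0 : {ae @leb01 R, forall x, sigma x * dx w x + 1 * primitive f x = 0}.
  apply: tested_eq0 => // phi Cphi.
  have phi2 : phi \in Lfun (@leb01 R) 2%:E by exact: (C0inf_Lfun2 0 Cphi).
  pose phi' : L2fun := Lfun_Sub (lee1n 2 : (1 <= 2%:E)%E) phi2.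
  pose v : H R := MkH (antider_inH phi').
  have dv : {ae @leb01 R, forall x, dx v x = phi x}.
    exact: (@dx_uniq _ v phi' (antider_weak_derivative phi')).
  have := eqn v; rewrite in_dualE// Rintegral_H// => E.
  under eq_Rintegral do rewrite mulrDl -[1 * _ * _]mulrA.
  rewrite Rintegral_lin; [|exact: C0inf_integrableM..].
  have -> : \int[leb01]_x (sigma x * dx w x * phi x) =
      \int[leb01]_x (sigma x * dx w x * dx v x).
    apply: eq_Rintegral_ae.
    - by apply: integrable01_measurable; exact: C0inf_integrableM.
    - exact: integrable01_measurable.
    - by move: dv; apply: ae01_impl => x ->.
  have -> : \int[leb01]_x (primitive f x * phi x) =
      \int[leb01]_x (dx v x * primitive f x).
    apply: eq_Rintegral_ae.
    - by apply: integrable01_measurable; exact: C0inf_integrableM.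
    - by apply: measurable_funM => //; exact: dx_measurable.
    - by move: dv; apply: ae01_impl => x ->; rewrite mulrC.
  by rewrite E mul1r addNr.
have := ae01_and h0 sc; apply: ae01_impl => x [+ /andP[sx _]].
have sx0 : sigma x != 0 by rewrite gt_eqF// (lt_le_trans c00).
rewrite mul1r => /eqP; rewrite addr_eq0 => /eqP swp.
by apply: (mulfI sx0); rewrite swp mulrN mulrCA mulfV// mulr1.
Qed.

Lemma dx_sum n (a : 'I_n -> R) (u : 'I_n -> H R) (s : seq 'I_n) :
  {ae @leb01 R, forall x, dx (\sum_(i <- s) a i *: u i) x = \sum_(i <- s) a i * dx (u i) x}.
Proof.
elim: s => [|i s IHs].
  rewrite big_nil; have := dx_lin (-1) 0 (0 : H R); rewrite scaler0 addr0.
  apply: ae01_impl => x /eqP; rewrite big_nil mulN1r addNr => /eqP//.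
rewrite big_cons; have := ae01_and IHs (dx_lin (a i) (u i) (\sum_(i <- s) a i *: u i)).
by apply: ae01_impl => x [E ->]; rewrite E big_cons.
Qed.

(** On test functions, the operator attached to the combination of resolvents is
    multiplication of the primitive by a fixed function. *)
Lemma dx_combination (c0 c1 : R) (tau : R -> R) N (sigma : 'I_N -> R -> R) (a : 'I_N -> R) f :
  0 < c0 -> Sigma0 c0 c1 tau -> (forall i, Sigma0 c0 c1 (sigma i)) -> C0inf f ->
  {ae @leb01 R, forall x,
    dx ((resolvent tau - \sum_(i < N) a i *: resolvent (sigma i)) (in_dual f)) x =
    (\sum_(i < N) a i / sigma i x - 1 / tau x) * primitive f x}.
Proof.
move=> c00 Stau Ssigma Cf.
have -> : (resolvent tau - \sum_(i < N) a i *: resolvent (sigma i)) (in_dual f) =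
   -1 *: (\sum_(i < N) a i *: resolvent (sigma i) (in_dual f)) + resolvent tau (in_dual f).
  transitivity (resolvent tau (in_dual f) -
      (\sum_(i < N) a i *: resolvent (sigma i)) (in_dual f)); first by [].
  by rewrite scaleN1r addrC fct_sumE.
have Es : {ae @leb01 R, forall x, forall i, dx (resolvent (sigma i) (in_dual f)) x =
    - (primitive f x / sigma i x)}.
  apply: (@filter_forall _ _ _ _ (ae_filter_ringOfSetsType (@leb01 R))) => i.
  exact: dx_resolvent c00 (Ssigma i) Cf.
have E1 := dx_lin (-1) (\sum_(i < N) a i *: resolvent (sigma i) (in_dual f))
  (resolvent tau (in_dual f)).
have E2 := dx_sum a (fun i => resolvent (sigma i) (in_dual f)) (index_enum 'I_N).
have := ae01_and (ae01_and E1 E2) (ae01_and Es (dx_resolvent c00 Stau Cf)).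
apply: ae01_impl => x [[e1 e2] [es et]]; apply: (etrans e1).
have e2' : \sum_(i < N) a i * dx (resolvent (sigma i) (in_dual f)) x =
    \sum_(i < N) a i * - (primitive f x / sigma i x).
  by apply: eq_bigr => i _; congr (_ * _); exact: es.
apply: (etrans (congr2 (fun y z => -1 * y + z) (etrans e2 e2') et)).
rewrite mulN1r mulrBl mulr_suml -sumrN; congr (_ + _); last by rewrite mul1r mulrC.
by apply: eq_bigr => i _; rewrite mulrN opprK [_ / sigma i x]mulrC mulrA.
Qed.

End resolvent_formula.

(** * Multiplication operators on the completion *)

Section multiplication_norm.
Context {R : realType}.
Implicit Types (f g h m phi : R -> R).

Lemma L1normE f : integrable01 f -> L1norm f = (\int[leb01]_x `|f x|)%:E.
Proof.
move=> If; rewrite /L1norm Lnorm1 fineK//=.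
exact: (integrable_fin_num _ (integrable_norm If)).
Qed.

Lemma L1norm_eq0 f : (forall x, f x = 0) -> L1norm f = 0%E.
Proof.
move=> f0; rewrite /L1norm Lnorm1 (_ : (fun x => _) = cst 0%E) ?integral0//.
by apply/funext => x /=; rewrite f0 normr0.
Qed.

Lemma L1norm_triangle f g : measurableR f -> measurableR g ->
  (L1norm f <= L1norm g + L1norm (f - g)%R)%E.
Proof.
move=> mf mg; rewrite /L1norm.
have -> : EFin \o f = EFin \o (g \+ (f - g)).
  by apply/funext => x /=; congr (_%:E); rewrite addrC -addrA addNr addr0.
by apply: minkowski_EFin => //; exact: measurable_funB.
Qed.

Lemma L1norm_sub f g : L1norm (f - g) = L1norm (g - f).
Proof.
rewrite /L1norm -[RHS]oppe_Lnorm; apply: eq_Lnorm => x /=.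
by congr (_%:E); rewrite opprB.
Qed.

Lemma eq_L1norm f g : measurableR f -> measurableR g ->
  {ae @leb01 R, forall x, f x = g x} -> L1norm f = L1norm g.
Proof.
move=> mf mg fg; rewrite /L1norm !Lnorm1; apply: ae_eq_integral => //.
- by apply: measurableT_comp => //; exact/measurable_EFinP.
- by apply: measurableT_comp => //; exact/measurable_EFinP.
by move: fg; apply: ae01_impl => x /= -> _.
Qed.

Lemma Linfnorm_leP m (M : \bar R) : (Linfnorm m <= M)%E <->
  {ae @leb01 R, forall x, (`|m x|%:E <= M)%E}.
Proof.
rewrite /Linfnorm unlock leb01_setT lte01.
by split=> [/ess_supP|h]; last apply/ess_supP.
Qed.

Lemma Linfnorm_ge0 m : (0 <= Linfnorm m)%E.
Proof. exact: Lnorm_ge0. Qed.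

Lemma L1norm_mult_le m h (M : R) : measurableR m -> measurableR h ->
  0 <= M -> {ae @leb01 R, forall x, (`|m x|%:E <= M%:E)%E} ->
  (L1norm (fun x => m x * h x)%R <= M%:E * L1norm h)%E.
Proof.
move=> mm mh M0 mM; rewrite /L1norm !Lnorm1 -ge0_integralZl//; last first.
  by apply: measurableT_comp => //; exact/measurable_EFinP.
apply: ae_ge0_le_integral => //.
- by apply: measurableT_comp => //; apply/measurable_EFinP; exact: measurable_funM.
- by move=> x _; rewrite mule_ge0.
- by apply: measurable_funeM; apply: measurableT_comp => //; exact/measurable_EFinP.
move: mM; apply: ae01_impl => x; rewrite lee_fin => mM _.
by rewrite /= -EFinM lee_fin normrM ler_wpM2r.
Qed.

Lemma primitive_integrable f : C0inf f -> integrable01 (primitive f).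
Proof. by move=> Cf; exact/Lfun2_integrable/primitive_Lfun2. Qed.

Lemma Wm11normE f : C0inf f -> Wm11norm f = (\int[leb01]_x `|primitive f x|)%:E.
Proof. by move=> Cf; rewrite /Wm11norm L1normE//; exact: primitive_integrable. Qed.

Lemma primitive_sub f g x : C0inf f -> C0inf g ->
  primitive (f - g) x = primitive f x - primitive g x.
Proof.
move=> Cf Cg; have I h : C0inf h -> mu.-integrable `[0, x] (EFin \o h).
  move=> Ch; apply: continuous_compact_integrable; first exact: segment_compact.
  by apply: continuous_subspaceT => y; exact: C0inf_cont.
by rewrite /primitive -RintegralB//; exact: I.
Qed.

Lemma primitiveZ f x (c : R) : C0inf f ->
  primitive (fun t => c * f t) x = c * primitive f x.
Proof.
move=> Cf; rewrite /primitive RintegralZl//.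
apply: continuous_compact_integrable; first exact: segment_compact.
by apply: continuous_subspaceT => y; exact: C0inf_cont.
Qed.

(** The norms of a Cauchy sequence form a Cauchy sequence of reals, so that the
    limit in [completed_norm] is a true limit. *)
Lemma completed_norm_cvg (w : Wm11 (R := R)) : Wm11norm (w n) @[n --> \oo] --> completed_norm w.
Proof.
pose r n := \int[leb01]_x `|primitive (w n) x|.
have wr n : Wm11norm (w n) = (r n)%:E by rewrite Wm11normE//; exact: Wm11_test.
have rle p q : ((r p)%:E <= (r q)%:E + Wm11norm (w p - w q)%R)%E.
  have -> : Wm11norm (w p - w q) = L1norm (primitive (w p) - primitive (w q)).
    by congr L1norm; apply/funext => x; exact: primitive_sub (Wm11_test w p) (Wm11_test w q).
  rewrite -!wr; apply: L1norm_triangle; apply: primitive_measurable; exact: Wm11_test.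
have cr : cvgn r.
  apply/cauchy_cvgP; apply: cauchy_exP => e /= e0.
  have [K wK] := Wm11_cauchy w e0.
  exists (r K); exists K => // n /= Kn.
  have h p q : (K <= p)%N -> (K <= q)%N -> r p < r q + e.
    move=> Kp Kq; rewrite -lte_fin EFinD; apply: le_lt_trans (rle p q) _.
    by rewrite lteD2lE// wK.
  by rewrite /ball/= ltr_distlC ltrBlDr !h.
have wE : (fun n => Wm11norm (w n)) = EFin \o r by apply/funext => n /=; exact: wr.
by rewrite /completed_norm wE EFin_lim//; apply: cvg_EFin => //; exact: nearW.
Qed.

(** When the images [L (w n)] converge, the bound passes to the limit; when they
    do not, the extension takes its default value, of norm 0. *)
Lemma extension_le (L : (R -> R) -> R -> R) m (M : R) (w : Wm11 (R := R)) : measurableR m ->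
  (forall f, C0inf f -> measurableR (L f) /\
     {ae @leb01 R, forall x, L f x = m x * primitive f x}) ->
  0 <= M -> {ae @leb01 R, forall x, (`|m x|%:E <= M%:E)%E} ->
  (completed_norm w <= 1)%E -> (L1norm (extension L w) <= M%:E)%E.
Proof.
move=> mm HL M0 mM w1; rewrite /extension; case: xgetP => [g _ /= gw|_]; last first.
  by rewrite L1norm_eq0.
have Ln n : (L1norm (L (w n)) <= M%:E * Wm11norm (w n))%E.
  have [mL Lm] := HL _ (Wm11_test w n).
  have mp := primitive_measurable (Wm11_test w n).
  have mmp : measurableR (fun x => m x * primitive (w n) x) by exact: measurable_funM.
  by rewrite (eq_L1norm mL mmp Lm); exact: L1norm_mult_le.
have gle n : (L1norm g <= M%:E * Wm11norm (w n) + L1norm (L (w n) - (g : R -> R))%R)%E.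
  have [mL _] := HL _ (Wm11_test w n).
  rewrite L1norm_sub; apply: le_trans (L1norm_triangle _ mL) _.
    by move: (LfunP g) => /Lfun_measurable.
  by rewrite leeD2r.
have cw := @completed_norm_cvg w.
have cvgB : (M%:E * Wm11norm (w n) + L1norm (L (w n) - (g : R -> R))%R)%E @[n --> \oo]
    --> (M%:E * completed_norm w)%E.
  rewrite -[X in _ --> X]adde0; apply: cvgeD; [|exact: cvgeZl|exact: gw].
  by rewrite fin_num_adde_defl.
apply: (@le_trans _ _ (M%:E * completed_norm w)%E).
  rewrite -(cvg_lim _ cvgB)//; apply: lime_ge; first by apply/cvg_ex; eexists; exact: cvgB.
  exact: nearW.
by rewrite -[leRHS]mule1 lee_wpmul2l.
Qed.

(** Constant Cauchy sequences put the images [L f] of the test functions among the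
    competitors in the supremum that defines [norm_m11]. *)
Lemma extension_cst (L : (R -> R) -> R -> R) f : C0inf f -> L f \in Lfun (@leb01 R) 1 ->
  exists2 w : Wm11 (R := R), completed_norm w = Wm11norm f &
    L1norm (extension L w) = L1norm (L f).
Proof.
move=> Cf Lf.
have cauchy_cst : forall e : R, 0 < e -> exists N, forall p q : nat,
    (N <= p)%N -> (N <= q)%N -> (Wm11norm (f - f)%R < e%:E)%E.
  move=> e e0; exists 0%N => _ _ _ _; rewrite /Wm11norm L1norm_eq0 ?lte_fin// => x.
  by rewrite primitive_sub// subrr.
pose w := @MkWm11 R (fun=> f) (fun=> Cf) cauchy_cst.
exists w.
  have -> : completed_norm w = limn (cst (Wm11norm f) : nat -> \bar R) by [].
  by apply: cvg_lim => //; exact: (cvg_cst (Wm11norm f)).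
rewrite /extension; case: xgetP => [g _ /= gw|/(_ (Lfun_Sub (lexx 1%E) Lf))]; last first.
  case; rewrite /= (_ : (fun _ => _) = cst 0%E); first exact: cvg_cst.
  by apply/funext => n /=; rewrite L1norm_eq0// => x; exact: subrr.
have Lfg : L1norm (L f - (g : R -> R)) = 0%E.
  by apply: (cvg_unique _ _ gw) => //; exact: cvg_cst.
have mg := Lfun_measurable (LfunP g); have mL := Lfun_measurable Lf.
apply/eqP; rewrite eq_le; apply/andP; split.
  by have := L1norm_triangle mg mL; rewrite L1norm_sub Lfg adde0.
by have := L1norm_triangle mL mg; rewrite Lfg adde0.
Qed.

(** [extension_le] is the upper bound.  Conversely, if [K] is the norm, the test
    function [phi^`() / d] with [d] just above the integral of [phi >= 0] lies in
    the unit ball, so that the integral of [(K - |m|) phi] is nonnegative, and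
    [tested_ge0] gives [|m| <= K] a.e. *)
Lemma norm_m11_multiplication (L : (R -> R) -> R -> R) m : integrable01 m ->
  (forall f, C0inf f -> L f \in Lfun (@leb01 R) 1 /\
     {ae @leb01 R, forall x, L f x = m x * primitive f x}) ->
  norm_m11 L = Linfnorm m.
Proof.
move=> Im HL; have mm := integrable01_measurable Im.
have HL' f : C0inf f -> measurableR (L f) /\
     {ae @leb01 R, forall x, L f x = m x * primitive f x}.
  by move=> /HL[/Lfun_measurable].
apply/eqP; rewrite eq_le; apply/andP; split.
  have [mM _] := Linfnorm_leP m (Linfnorm m); have {}mM := mM (lexx _).
  have := Linfnorm_ge0 m; case: (Linfnorm m) mM => [M mM M0|_ _|//]; last exact: leey.
  apply: ub_ereal_sup => _ [w w1 <-]; exact: extension_le HL' _ mM w1.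
(* lower bound: test functions embed as constant Cauchy sequences *)
have Lsup f : C0inf f -> (Wm11norm f <= 1)%E -> (L1norm (L f) <= norm_m11 L)%E.
  move=> Cf f1; have [Lf _] := HL _ Cf; have [w wf <-] := extension_cst Cf Lf.
  by apply: ereal_sup_ubound; exists w => //=; rewrite wf.
have K0 : (0 <= norm_m11 L)%E.
  apply: le_trans (Lsup _ C0inf0 _); first exact: Lnorm_ge0.
  by rewrite /Wm11norm L1norm_eq0 ?lee01// => x; rewrite /primitive Rintegral_cst// mul0r.
case: (norm_m11 L) K0 Lsup => [K K0 Lsup|_ _|//]; last exact: leey.
apply/Linfnorm_leP.
have Iam := integrable_norm Im.
have IK : integrable01 (fun=> K).
  by apply: (@integrable_bdd _ _ `|K|); [exact: measurable_cst|exact: ae01_all].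
suff : {ae @leb01 R, forall x, 0 <= K + -1 * `|m x|}.
  by apply: ae01_impl => x; rewrite mulN1r subr_ge0 lee_fin.
apply: tested_ge0.
  by have := integrableD measurableT IK (integrableZl measurableT (-1) Iam).
move=> phi Cphi phi0.
have Iphi := C0inf_integrable Cphi.
have Imphi := C0inf_integrableM Cphi Iam.
under eq_Rintegral do rewrite mulrDl -[-1 * _ * _]mulrA.
rewrite Rintegral_lin//; last exact: C0inf_integrableM.
rewrite (RintegralZl _ measurableT Iphi) mulN1r subr_ge0.
set I := \int[leb01]_x phi x.
have I0 : 0 <= I by apply: Rintegral_ge0 => x _; exact: phi0.
apply/ler_addgt0Pr => e e0.
have K1 : 0 < K + 1 by rewrite ltr_wpDl.
(* The test function is the derivative of phi divided by d, of norm I / d <= 1;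
   d exceeds I, which may vanish, by an amount that costs at most e. *)
pose d := I + e / (K + 1).
have d0 : 0 < d by rewrite ltr_wpDl// divr_gt0.
pose f x := d^-1 * derive1 phi x.
have Cf : C0inf f by apply: C0infZ; exact: C0inf_derive1.
have pf x : primitive f x = d^-1 * phi x.
  by rewrite primitiveZ ?primitive_derive1//; exact: C0inf_derive1.
have f1 : (Wm11norm f <= 1)%E.
  rewrite Wm11normE//.
  under eq_Rintegral do rewrite pf ger0_norm ?mulr_ge0 ?invr_ge0 ?(ltW d0)//.
  rewrite (RintegralZl _ measurableT Iphi) lee_fin mulrC ler_pdivrMr// mul1r.
  by rewrite lerDl divr_ge0 ?ltW.
have := Lsup f Cf f1; have [Lf Lfm] := HL' f Cf.
have mmp : measurableR (fun x => m x * primitive f x).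
  by apply: measurable_funM => //; exact: primitive_measurable.
have Imp : integrable01 (fun x => m x * primitive f x).
  have := integrableZl measurableT d^-1 (C0inf_integrableM Cphi Im).
  rewrite (_ : (fun x => _) = EFin \o (fun x => m x * primitive f x))//.
  by apply/funext => x /=; rewrite pf mulrCA.
rewrite (eq_L1norm Lf mmp Lfm) L1normE// lee_fin.
under eq_Rintegral do rewrite normrM pf (ger0_norm (mulr_ge0 _ _)) ?invr_ge0 ?(ltW d0)// mulrCA.
rewrite (RintegralZl _ measurableT Imphi) mulrC ler_pdivrMr// => H.
apply: (le_trans H); rewrite /d mulrDr lerD2l mulrCA ger_pMr//.
by rewrite ler_pdivrMr// mul1r lerDl.
Qed.

End multiplication_norm.

(** * The star norm of a combination of resolvents *)

Section star.
Context {R : realType}.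

Lemma inv_integrable (c0 c1 : R) (sigma : R -> R) : 0 < c0 -> Sigma0 c0 c1 sigma ->
  integrable01 (fun x => 1 / sigma x).
Proof.
move=> c00 [sL sc]; apply: (@integrable_bdd _ _ c0^-1).
  apply: measurable_funM; first exact: measurable_cst.
  exact: measurable_inv (Lfun_measurable sL).
move: sc; apply: ae01_impl => x /andP[sx _]; have sx0 := lt_le_trans c00 sx.
by rewrite mul1r normfV gtr0_norm// lef_pV2.
Qed.

Lemma combination_integrable (c0 c1 : R) (tau : R -> R) N (sigma : 'I_N -> R -> R)
    (a : 'I_N -> R) : 0 < c0 -> Sigma0 c0 c1 tau -> (forall i, Sigma0 c0 c1 (sigma i)) ->
  integrable01 (fun x => \sum_(i < N) a i / sigma i x - 1 / tau x).
Proof.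
move=> c00 Stau Ssigma.
have Is (s : seq 'I_N) : integrable01 (fun x => \sum_(i <- s) a i / sigma i x).
  elim: s => [|i s IHs].
    rewrite (_ : (fun x => _) = (fun=> 0)); last by apply/funext => x; rewrite big_nil.
    apply: (@integrable_bdd _ _ 0); first exact: measurable_cst.
    by apply: ae01_all => x; rewrite normr0.
  have I1 := integrableZl measurableT (a i) (inv_integrable c00 (Ssigma i)).
  have := integrableD measurableT I1 IHs.
  rewrite (_ : (fun x => _) = EFin \o (fun x => \sum_(j <- i :: s) a j / sigma j x))//.
  by apply/funext => x /=; rewrite big_cons mul1r EFinD EFinM.
by have := integrableB measurableT (Is (index_enum 'I_N)) (inv_integrable c00 Stau).
Qed.

Lemma star_normE (c0 c1 : R) (tau : R -> R) N (sigma : 'I_N -> R -> R)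
    (a : 'I_N -> R) : 0 < c0 -> Sigma0 c0 c1 tau -> (forall i, Sigma0 c0 c1 (sigma i)) ->
  star_norm (resolvent tau - \sum_(i < N) a i *: resolvent (sigma i)) =
  Linfnorm (fun x => \sum_(i < N) a i / sigma i x - 1 / tau x).
Proof.
move=> c00 Stau Ssigma; apply: norm_m11_multiplication.
  exact: combination_integrable Stau Ssigma.
move=> f Cf; split; last exact: dx_combination Stau Ssigma Cf.
apply: Lfun_subset12; last exact: LfunP.
exact: leb01_fin_num.
Qed.

Lemma Linfnorm_opp (f g : R -> R) : (forall x, g x = - f x) -> Linfnorm g = Linfnorm f.
Proof.
move=> gf; rewrite /Linfnorm -[RHS]oppe_Lnorm; apply: eq_Lnorm => x /=.
by rewrite gf.
Qed.

End star.

Unset Implicit Arguments.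
Theorem mainTheorem6 (R : realType) (c0 c1 : R) (hc0 : 0 < c0) (hc01 : c0 < c1)
    (N : nat) (hN : (2 <= N)%N) (tau : R -> R) (sigma : 'I_N -> R -> R)
    (htau : Sigma0 c0 c1 tau) (hsigma : forall i, Sigma0 c0 c1 (sigma i)) :
  (forall a : 'I_N -> R,
    star_norm (resolvent tau - \sum_(i < N) a i *: resolvent (sigma i)) =
    Linfnorm (fun x => \sum_(i < N) a i / sigma i x - 1 / tau x)) /\
  dist_to star_norm (resolvent tau)
    (span_of (fun i => resolvent (sigma i))) =
  dist_to Linfnorm (fun x => 1 / tau x)
    (span_of (fun i x => 1 / sigma i x)).
Proof.
have E a := star_normE a hc0 htau hsigma.
have E' a : star_norm (resolvent tau - \sum_(i < N) a i *: resolvent (sigma i)) =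
    Linfnorm ((fun x => 1 / tau x) - \sum_(i < N) a i *: (fun x => 1 / sigma i x)).
  rewrite E; apply: Linfnorm_opp => x.
  have -> : ((fun x => 1 / tau x) - \sum_(i < N) a i *: (fun x => 1 / sigma i x)) x =
     1 / tau x - (\sum_(i < N) a i *: (fun x => 1 / sigma i x)) x by [].
  rewrite fct_sumE opprB; congr (_ - _); apply: eq_bigr => i _.
  by rewrite [RHS]/GRing.scale/= mul1r.
split; first exact: E.
rewrite /dist_to; congr ereal_inf; apply/seteqP; split=> _ [_ [a _ <-] <-].
- exists (\sum_(i < N) a i *: (fun x => 1 / sigma i x)); first by exists a.
  exact/esym/E'.
- exists (\sum_(i < N) a i *: resolvent (sigma i)); first by exists a.
  exact: E'.
Qed.
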